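(* There exist numerical constants $0<c_0,c_1,c_2<\infty$ and, for every $p\in\mathbb{N}$, a positive number $\ell_p'\le e^{c_1p\log p+c_1}$ depending only on $p$, such that the following holds. For any $p\in\mathbb{N}$, $p\ge1$, let $D$, $L_p$ and $\epsilon$ be positive. Then $$\mathcal{T}_\epsilon\big(\mathcal{A}_{\mathsf{rand}},\mathcal{F}^{\mathrm{dist}}_p(D,L_p)\big)\ \ge\ c_0\cdot D^{1+p}\left(\frac{L_p}{\ell_p'}\right)^{\frac{1+p}{p}}\epsilon^{-\frac{1+p}{p}}.$$ Moreover, this lower bound holds even if $\mathcal{F}^{\mathrm{dist}}_p(D,L_p)$ is restricted to functions whose domain $\mathbb{R}^d$ has dimension $$d=\left\lceil\max\left\{1,\ 1+c_2\,q\!\left(D^{1+p}\left(\frac{L_p}{\ell_p'}\right)^{\frac{1+p}{p}}\epsilon^{-\frac{1+p}{p}}\right)\right\}\right\rceil,\qquad q(x)=x^2\log(2x).$$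
   Context: $\mathbb{N}=\{1,2,\dots\}$ and $\|\cdot\|$ is the Euclidean norm. Function class. A function $f:\mathbb{R}^d\to\mathbb{R}$ has $L_p$-Lipschitz $p$th order derivatives if it is $p$ times continuously differentiable and for every $x\in\mathbb{R}^d$ and $v\in\mathbb{R}^d$ with $\|v\|\le1$ the function $f_{x,v}(t):=f(x+tv)$, $t\in\mathbb{R}$, satisfies $|f_{x,v}^{(p)}(t)-f_{x,v}^{(p)}(t')|\le L_p|t-t'|$ for all $t,t'\in\mathbb{R}$. $\mathcal{F}^{\mathrm{dist}}_p(D,L_p)$ is the class (over all $d\in\mathbb{N}$) of $C^\infty$ functions $f:\mathbb{R}^d\to\mathbb{R}$ with $L_p$-Lipschitz $p$th order derivatives satisfying $\sup_x\{\|x\|\mid x\in\arg\min f\}\le D$, that is, all global minima have distance at most $D$ to the origin. Algorithms. For a function $f$, let $\nabla^{(0,1,\dots)}f(x)$ denote the collection of $f(x)$ and all derivatives $\nabla f(x),\nabla^2 f(x),\dots$ at $x$. A randomized algorithm $\mathsf{A}$ consists, for every dimension $d$, of measurable mappings $\mathsf{A}^{(i)}$ ($i\in\mathbb{N}$) into $\mathbb{R}^d$ (dependence on $d$ implicit); operating on $f:\mathbb{R}^d\to\mathbb{R}$ it draws $\xi\sim\mathrm{Uniform}[0,1]$ independently of $f$ and produces the random sequence of iterates $\mathsf{A}[f]=\{x^{(t)}\}_{t\in\mathbb{N}}\subset\mathbb{R}^d$ given by $$x^{(i)}=\mathsf{A}^{(i)}\big(\xi,\nabla^{(0,1,\dots)}f(x^{(1)}),\dots,\nabla^{(0,1,\dots)}f(x^{(i-1)})\big),\quad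 i\in\mathbb{N}.$$ $\mathcal{A}_{\mathsf{rand}}$ is the class of all such randomized algorithms. Complexity. For a random process $\{x^{(t)}\}_{t\in\mathbb{N}}$ with law $P$, $$\mathsf{T}_\epsilon(P,f):=\inf\Big\{t\in\mathbb{N}\ \Big|\ P\big(\|\nabla f(x^{(s)})\|>\epsilon\text{ for all }s\le t\big)\le\tfrac12\Big\},$$ and $\mathsf{T}_\epsilon(\mathsf{A},f)$ is this quantity for the law of $\mathsf{A}[f]$. For an algorithm class $\mathcal{A}$ and function class $\mathcal{F}$, $\mathcal{T}_\epsilon(\mathcal{A},\mathcal{F}):=\inf_{\mathsf{A}\in\mathcal{A}}\sup_{f\in\mathcal{F}}\mathsf{T}_\epsilon(\mathsf{A},f)$. *)

(* Defs.v *)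
From mathcomp Require Import all_boot all_order all_algebra.
From mathcomp Require Import all_classical all_reals all_analysis.

Set Implicit Arguments.
Unset Strict Implicit.
Unset Printing Implicit Defensive.

Import Order.TTheory GRing.Theory Num.Theory.
Import numFieldNormedType.Exports.

Local Open Scope classical_set_scope.
Local Open Scope ring_scope.

(* The norm that the library puts on 'rV[R]_d is the sup norm; it serves only
   for the topology and differentiability (the same for all norms on R^d). *)
Definition enorm (R : realType) (d : nat) (x : 'rV[R]_d) : R :=
  Num.sqrt (\sum_(j < d) x 0 j ^+ 2).

Definition grad (R : realType) (d : nat) (f : 'rV[R]_d -> R) (x : 'rV[R]_d) :
    'rV[R]_d :=
  \row_(j < d) 'D_('e_j) f x.

(* [partials [:: j_1; ..; j_q] f] is d_{j_1} .. d_{j_q} f, that is, the entry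
   (j_1, .., j_q) of the tensor of q-th derivatives. *)
Definition partials (R : realType) (d : nat) (s : seq 'I_d)
    (f : 'rV[R]_d -> R) : 'rV[R]_d -> R :=
  foldr (fun j g => 'D_('e_j) g) f s.

Fixpoint Ck (R : realType) (d : nat) (k : nat) (f : 'rV[R]_d -> R) : Prop :=
  if k is k'.+1 then
    (forall x, differentiable f x) /\ (forall j : 'I_d, Ck k' ('D_('e_j) f))
  else continuous f.

Definition Cinfty (R : realType) (d : nat) (f : 'rV[R]_d -> R) : Prop :=
  forall k, Ck k f.

Definition lipschitz_derivatives (R : realType) (d : nat) (p : nat) (L : R)
    (f : 'rV[R]_d -> R) : Prop :=
  Ck p f /\
  forall x v : 'rV[R]_d, enorm v <= 1 ->
    let fxv := fun t : R => f (x + t *: v) in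
    forall t t' : R, `|derive1n p fxv t - derive1n p fxv t'| <= L * `|t - t'|.

Definition argmin (R : realType) (d : nat) (f : 'rV[R]_d -> R) :
    set 'rV[R]_d :=
  [set x | forall y, f x <= f y].

(* A function together with its dimension. *)
Definition objective (R : realType) : Type := {d : nat & 'rV[R]_d -> R}.

(* The supremum is that of a nonempty set of minimizers: if functions without
   minimizers were admitted, linear functions would make every lower bound on
   the complexity of the class trivial. *)
Definition Fdist (R : realType) (p : nat) (D L : R) : set (objective R) :=
  [set F | [/\ (0 < tag F)%N,
               Cinfty (tagged F),
               lipschitz_derivatives p L (tagged F),
               argmin (tagged F) !=set0 &
               (ereal_sup [set (enorm x)%:E | x in argmin (tagged F)]
                  <= D%:E)%E]].

(* Generators of the coarsest sigma-algebra on X for which all the maps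
   [pr i : X -> T] are measurable. *)
Definition coordinate_sets (disp : measure_display)
    (T : measurableType disp) (I X : Type) (pr : I -> X -> T) : set (set X) :=
  [set pr i @^-1` B | i in setT & B in measurable].

(* R^d with its Borel sigma-algebra. *)
Definition point (R : realType) (d : nat) : Type :=
  g_sigma_algebraType
    (coordinate_sets (fun (j : 'I_d) (x : 'rV[R]_d) => x 0 j)).

(* The values at a point of all partial derivatives of all orders, order 0
   included ([s = [::]]), with the product sigma-algebra. *)
Definition jets (R : realType) (d : nat) : Type :=
  g_sigma_algebraType
    (coordinate_sets (fun (s : seq 'I_d) (h : seq 'I_d -> R) => h s)).

Definition trajectory (R : realType) (d : nat) : Type :=
  g_sigma_algebraType
    (coordinate_sets (fun (t : nat) (x : nat -> point R d) => x t)).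

(* Iterates are numbered from 0: [A d i] is the (i+1)-st mapping, which reads
   the random seed and the jets of f at the i previous iterates. *)
Definition algorithm (R : realType) : Type :=
  forall d i : nat, measurableTypeR R * i.-tuple (jets R d) -> point R d.

Definition Arand (R : realType) : set (algorithm R) :=
  [set A | forall d i : nat,
     measurable_fun
       ((`[0, 1] : set (measurableTypeR R)) `*` [set: i.-tuple (jets R d)])
       (A d i)].

Definition jets_at (R : realType) (d : nat) (f : 'rV[R]_d -> R)
    (x : point R d) : jets R d :=
  fun s => partials s f x.

Fixpoint history (R : realType) (A : algorithm R) (d : nat)
    (f : 'rV[R]_d -> R) (xi : R) (i : nat) : i.-tuple (jets R d) :=
  if i is i'.+1 then
    let h := history A f xi i' in
    [tuple of rcons h (jets_at f (A d i' (xi, h)))]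
  else [tuple].

Definition iterates (R : realType) (A : algorithm R) (d : nat)
    (f : 'rV[R]_d -> R) (xi : R) : trajectory R d :=
  fun i => A d i (xi, history A f xi i).

Definition law (R : realType) (A : algorithm R) (d : nat)
    (f : 'rV[R]_d -> R) : set (trajectory R d) -> \bar R :=
  pushforward (uniform_prob (@ltr01 R)) (iterates A f).

(* As iterates are numbered from 0, the first t of them are those with s < t. *)
Definition Teps (R : realType) (eps : R) (d : nat)
    (P : set (trajectory R d) -> \bar R) (f : 'rV[R]_d -> R) : \bar R :=
  ereal_inf [set t%:R%:E | t in [set t : nat | (1 <= t)%N /\
    (P [set x : trajectory R d |
          forall s, (s < t)%N -> (eps < enorm (grad f (x s)))%R]
       <= (2^-1)%:E)%E]].

Definition complexity (R : realType) (eps : R) (AA : set (algorithm R))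
    (FF : set (objective R)) : \bar R :=
  ereal_inf [set ereal_sup [set Teps eps (law A (tagged F)) (tagged F)
                           | F in FF]
            | A in AA].

(* Main.v *)
Require Import Defs.
From mathcomp Require Import all_boot all_order all_algebra.
From mathcomp Require Import all_classical all_reals all_analysis.
From mathcomp Require Import measurable_realfun zify ring lra.

Set Implicit Arguments.
Unset Strict Implicit.
Unset Printing Implicit Defensive.

Import Order.TTheory GRing.Theory Num.Theory.
Import numFieldNormedType.Exports.

Local Open Scope classical_set_scope.
Local Open Scope ring_scope.

(* Split the first (T + 1) m coordinates into blocks of m; block b hides the
   unit vector u_b with entries +-1/sqrt m for random signs. With the bump
   E(y) = exp (- 1 / y), y > 0, the hard function is, up to scaling,
     beta/2 |x|^2 - sum_(b < T) E(1/4 - |x_(b-1) - u_(b-1)|^2) E(5 - |x_b - u_b|^2)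
   (with first factor 1 for b = 0), minus a deep narrow spike around u_T, which
   contains all the global minima and keeps them near the origin. The first
   block that is not yet close to its hidden vector has a large gradient, and
   the b-th term vanishes locally unless block b - 1 of the query lies within
   1/2 of u_(b-1). Hence each query reveals the signs of only one further block
   unless it hits an unknown u_b, which, by a Chernoff bound for the signs, has
   probability at most exp (- 3 m / 32) whatever the query is. Averaging over
   the seed of the algorithm yields one choice of signs that defeats it with
   probability greater than 1/2. The derivative bounds are dimension-free since
   each block occurs in two terms and the derivatives have order p + 1 >= 2. *)

(** * Smooth functions *)

Section PointwiseDerive.
Variables (R : realType) (V : normedModType R).
Implicit Types (f g : V -> R) (x v : V).

Lemma is_derive_addf f g x v (a b : R) : is_derive x v f a -> is_derive x v g b ->
  is_derive x v (fun y => f y + g y) (a + b).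
Proof. exact: is_deriveD. Qed.

Lemma is_derive_oppf f x v (a : R) : is_derive x v f a ->
  is_derive x v (fun y => - f y) (- a).
Proof. exact: is_deriveN. Qed.

Lemma is_derive_mulf f g x v (a b : R) : is_derive x v f a -> is_derive x v g b ->
  is_derive x v (fun y => f y * g y) (a * g x + f x * b).
Proof. by move=> df dg; apply: is_derive_eq; rewrite /= addrC [a * _]mulrC. Qed.

Lemma is_derive_scalef (c : R) f x v (a : R) : is_derive x v f a ->
  is_derive x v (fun y => c * f y) (c * a).
Proof. exact: is_deriveZ. Qed.

Lemma is_derive_compf (h g : R -> R) (x a b : R) :
  is_derive (g x) 1 h a -> is_derive x 1 g b ->
  is_derive x 1 (fun y => h (g y)) (a * b).
Proof. exact: is_derive1_comp. Qed.

Lemma is_derive_sumf (I : Type) (r : seq I) (P : pred I) (F : I -> V -> R)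
    (dF : I -> R) x v :
  (forall i, P i -> is_derive x v (F i) (dF i)) ->
  is_derive x v (fun y => \sum_(i <- r | P i) F i y) (\sum_(i <- r | P i) dF i).
Proof.
move=> dFi; elim: r => [|i r IH].
  rewrite big_nil (_ : (fun _ => _) = cst 0); first exact: is_derive_cst.
  by apply/funext => y; rewrite big_nil.
rewrite big_cons (_ : (fun _ => _) =
    (fun y => if P i then F i y + \sum_(j <- r | P j) F j y
              else \sum_(j <- r | P j) F j y)); last first.
  by apply/funext => y; rewrite big_cons.
by case: ifP => // /dFi dFix; exact: is_derive_addf.
Qed.

End PointwiseDerive.

(** * The flat function exp (- 1 / x) and its derivatives *)

Section Flat.
Variable R : realType.

(* The derivatives of exp (- 1 / x) are integer combinations of the [flat k]. *)
Definition flat (k : nat) (x : R) : R :=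
  if 0 < x then x^-1 ^+ k * expR (- x^-1) else 0.

Lemma flat_le0 k x : x <= 0 -> flat k x = 0.
Proof. by rewrite /flat ltNge => ->. Qed.

Lemma flat_gt0 k x : 0 < x -> 0 < flat k x.
Proof.
by move=> x0; rewrite /flat x0 mulr_gt0 ?expR_gt0// exprn_gt0// invr_gt0.
Qed.

Lemma flat_ge0 k x : 0 <= flat k x.
Proof.
have [x0|x0] := ltP 0 x; first exact/ltW/flat_gt0.
by rewrite flat_le0.
Qed.

(** For k > 0, raise [y / k <= expR (y / k)] to the k-th power; for k = 0 the bound is 0 ^ 0 = 1. *)
Lemma exprn_expRN_le (k : nat) (y : R) : 0 <= y -> y ^+ k * expR (- y) <= k%:R ^+ k.
Proof.
move=> y0; case: k => [|k].
  by rewrite !expr0 mul1r -expR0 ler_expR oppr_le0.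
rewrite expRN ler_pdivrMr ?expR_gt0//.
have -> : expR y = expR (y / k.+1%:R) ^+ k.+1.
  by rewrite -expRM_natl mulrC divfK// pnatr_eq0.
rewrite -exprMn ler_pXn2r ?nnegrE ?mulr_ge0 ?expR_ge0 ?ler0n//.
rewrite mulrC -ler_pdivrMr ?ltr0n//.
by apply: le_trans (expR_ge1Dx _); rewrite lerDr.
Qed.

Lemma flat_le k x : flat k x <= k%:R ^+ k.
Proof.
rewrite /flat; case: ifPn => [x0|_]; last by rewrite exprn_ge0// ler0n.
by rewrite exprn_expRN_le// invr_ge0 ltW.
Qed.

Lemma flat0_le1 x : flat 0 x <= 1.
Proof. by have := flat_le 0 x; rewrite expr0. Qed.

(** Two orders are traded for a factor [x ^+ 2]; this decay makes the derivative of [flat k] at 0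
    vanish. *)
Lemma flat_le_sqr k x : flat k x <= k.+2%:R ^+ k.+2 * x ^+ 2.
Proof.
have [x0|x0] := ltP 0 x; last first.
  by rewrite flat_le0// mulr_ge0 ?sqr_ge0// exprn_ge0// ler0n.
have -> : flat k x = flat k.+2 x * x ^+ 2.
  rewrite /flat x0 mulrAC; congr (_ * _).
  by rewrite -addn2 exprD -mulrA -exprMn mulVf ?gt_eqF// expr1n mulr1.
by rewrite ler_wpM2r ?sqr_ge0// flat_le.
Qed.

Lemma is_derive_flat k (x : R) :
  is_derive x 1 (flat k) (flat k.+2 x - k%:R * flat k.+1 x).
Proof.
case: (ltrgtP x 0) => [x0|x0|->].
- rewrite !(flat_le0 _ (ltW x0)) mulr0 subr0.
  apply: (@near_eq_is_derive R R R (cst 0)).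
  by near=> y; rewrite flat_le0// ltW//; near: y; exact: lt_nbhsl.
- have xn0 : x != 0 by rewrite gt_eqF.
  apply: (@near_eq_is_derive R R R (fun y => y^-1 ^+ k * expR (- y^-1))).
    near=> y; rewrite /flat ifT//; near: y.
    exact: lt_nbhsr.
  have dV : is_derive x 1 (fun y : R => y^-1) (- x^-1 ^+ 2).
    have := @is_deriveV R id x 1 1 xn0 (is_derive_id _ _).
    by rewrite /= exprVn [_ *: _]mulr1.
  have dE : is_derive x 1 (fun y : R => expR (- y^-1)) (expR (- x^-1) * - - x^-1 ^+ 2).
    exact: is_derive_compf (is_derive_oppf dV).
  have dX : is_derive x 1 (fun y : R => y^-1 ^+ k) (k%:R * x^-1 ^+ k.-1 * - x^-1 ^+ 2).
    have := @is_deriveX R R (fun y : R => y^-1) k x 1 _ dV.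
    by rewrite exprfctE.
  apply: (is_derive_eq (is_derive_mulf dX dE)).
  rewrite /flat x0 /=; case: (k) => [|n] /=; rewrite ?exprS; ring.
- rewrite !flat_le0// mulr0 subr0.
  set C : R := k.+2%:R ^+ k.+2.
  have C0 : 0 < C by rewrite exprn_gt0// ltr0n.
  (* By [flat_le_sqr] the difference quotient at 0 is at most [C * |h|] in absolute value. *)
  have lim0 : (fun h : R => h^-1 *: (flat k (h *: 1 + 0) - flat k 0)) @ 0^' --> (0 : R).
    apply/cvgrPdist_le => e e0; near=> h.
    have h0 : h != 0 by near: h; exact: nbhs_dnbhs_neq.
    rewrite (flat_le0 k (lexx 0)) subr0 addr0 sub0r normrN [h *: 1]mulr1.
    rewrite [_ *: _]/(_ * _) normrM normfV (ger0_norm (flat_ge0 _ _)).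
    rewrite mulrC ler_pdivrMr ?normr_gt0//.
    apply: le_trans (flat_le_sqr _ _) _; rewrite -/C -real_normK ?num_real// expr2 mulrA.
    rewrite ler_wpM2r//= mulrC -ler_pdivlMr//.
    near: h; apply: dnbhs0_le; exact: divr_gt0.
  by apply: DeriveDef; [apply/cvg_ex; exists 0 | exact: cvg_lim lim0].
Unshelve. all: by end_near. Qed.

End Flat.

(** * Closure properties of C^k functions *)

Section SmoothClosure.
Variables (R : realType) (d : nat).
Implicit Types (f g : 'rV[R]_d -> R) (k : nat).

Lemma Ck_leS k f : Ck k.+1 f -> Ck k f.
Proof.
elim: k f => [|k IH] f [df Df] /=.
  by move=> x; exact/differentiable_continuous.
by split=> // j; exact/IH/Df.
Qed.

Lemma Ck_differentiable k f x : Ck k.+1 f -> differentiable f x.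
Proof. by case. Qed.

Lemma Ck_is_derive k f (x v : 'rV[R]_d) : Ck k.+1 f -> is_derive x v f ('D_v f x).
Proof. by move=> /Ck_differentiable dfx; exact/derivableP/diff_derivable. Qed.

Lemma Ck_cst k (c : R) : Ck k (fun _ : 'rV[R]_d => c).
Proof.
elim: k c => [|k IH] c /=; first exact: cst_continuous.
split=> [x|j]; first exact: differentiable_cst.
rewrite (_ : 'D_('e_j) _ = fun=> 0); first exact: IH.
by apply/funext => x; exact: derive_cst.
Qed.

Lemma Ck_add k f g : Ck k f -> Ck k g -> Ck k (fun x => f x + g x).
Proof.
elim: k f g => [|k IH] f g Cf Cg; first by move=> x; exact: (continuousD (Cf x) (Cg x)).
split=> [x|j]; first exact: (differentiableD (Cf.1 x) (Cg.1 x)).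
rewrite (_ : 'D_('e_j) _ = fun x => 'D_('e_j) f x + 'D_('e_j) g x).
  by apply: IH; [exact: Cf.2 | exact: Cg.2].
apply/funext => x; apply: (@derive_val _ _ _ _ _ (fun x => f x + g x)).
exact: is_derive_addf (Ck_is_derive _ _ Cf) (Ck_is_derive _ _ Cg).
Qed.

Lemma Ck_mul k f g : Ck k f -> Ck k g -> Ck k (fun x => f x * g x).
Proof.
elim: k f g => [|k IH] f g Cf Cg; first by move=> x; exact: (continuousM (Cf x) (Cg x)).
split=> [x|j]; first exact: (differentiableM (Cf.1 x) (Cg.1 x)).
rewrite (_ : 'D_('e_j) _ = fun x => 'D_('e_j) f x * g x + f x * 'D_('e_j) g x).
  by apply: Ck_add; apply: IH; [exact: Cf.2|exact: Ck_leS|exact: Ck_leS|exact: Cg.2].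
apply/funext => x; apply: (@derive_val _ _ _ _ _ (fun x => f x * g x)).
exact: is_derive_mulf (Ck_is_derive _ _ Cf) (Ck_is_derive _ _ Cg).
Qed.

Lemma Ck_scale k (c : R) f : Ck k f -> Ck k (fun x => c * f x).
Proof. exact/Ck_mul/Ck_cst. Qed.

Lemma Ck_opp k f : Ck k f -> Ck k (fun x => - f x).
Proof.
by move=> /(Ck_scale (-1)); congr Ck; apply/funext => x; rewrite mulN1r.
Qed.

Lemma Ck_sum k (I : Type) (r : seq I) (P : pred I) (F : I -> 'rV[R]_d -> R) :
  (forall i, P i -> Ck k (F i)) -> Ck k (fun x => \sum_(i <- r | P i) F i x).
Proof.
move=> CF; elim: r => [|i r IH].
  rewrite (_ : (fun _ => _) = fun=> 0); first exact: Ck_cst.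
  by apply/funext => x; rewrite big_nil.
rewrite (_ : (fun _ => _) = fun x =>
  (if P i then F i x else 0) + \sum_(j <- r | P j) F j x).
  by apply: Ck_add => //; case: (boolP (P i)) => [/CF|_] //; exact: Ck_cst.
by apply/funext => x; rewrite big_cons; case: (P i); rewrite ?add0r.
Qed.

Lemma is_derive_coord (i : 'I_d) (x v : 'rV[R]_d) :
  is_derive x v (fun y : 'rV[R]_d => y 0 i) (v 0 i).
Proof.
apply: DeriveDef; first exact/diff_derivable/differentiable_coord.
rewrite deriveE; last exact: differentiable_coord.
(* Packaged as a linear map, the coordinate is its own differential. *)
have @L : {linear 'rV[R]_d -> R}.
  by exists (fun N : 'rV[R]_d => N 0 i); do 2![eexists]; do ?[constructor];
     rewrite ?mxE// => ? *; rewrite ?mxE//; move=> ?; rewrite !mxE.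
rewrite (_ : (fun _ => _) = L)// diff_lin//; exact: coord_continuous.
Qed.

Lemma Ck_coord k (i : 'I_d) : Ck k (fun x : 'rV[R]_d => x 0 i).
Proof.
case: k => [|k]; first exact: coord_continuous.
split=> [x|j]; first exact: differentiable_coord.
rewrite (_ : 'D_('e_j) _ = fun=> ('e_j : 'rV[R]_d) 0 i); first exact: Ck_cst.
apply/funext => x; exact: (@derive_val _ _ _ _ _ _ _ (is_derive_coord i x _)).
Qed.

Lemma is_derive_flat_comp k f (x v : 'rV[R]_d) : differentiable f x ->
  is_derive x v (fun y => flat k (f y))
    ((flat k.+2 (f x) - k%:R * flat k.+1 (f x)) * 'D_v f x).
Proof.
move=> df; have dF := is_derive_flat k (f x).
have diffF : differentiable (flat k : R -> R) (f x).
  exact/derivable1_diffP.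
have dfl : differentiable (flat k \o f) x by exact: differentiable_comp.
apply: DeriveDef; first exact: diff_derivable.
transitivity ('d (flat k) (f x) ('D_v f x)).
  by rewrite -[LHS]/('D_v (flat k \o f) x) !deriveE// diff_comp.
(* Writing the argument as a multiple of 1 lets linearity turn the differential into a
   one-dimensional derivative. *)
have -> : 'd (flat k : R -> R) (f x) ('D_v f x) = 'd (flat k : R -> R) (f x) ('D_v f x *: (1 : R)).
  by rewrite /GRing.scale /= mulr1.
by rewrite linearZ -deriveE// derive_val; exact: mulrC.
Qed.

(** The order [n] stays free in the induction, since differentiation raises it. *)
Lemma Ck_flat k n f : Ck k f -> Ck k (fun x => flat n (f x)).
Proof.
elim: k n f => [|k IH] n f Cf.
  move=> x; apply: (@continuous_comp _ _ _ f (flat n)); first exact: Cf.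
  by apply: differentiable_continuous; apply/derivable1_diffP; case: (is_derive_flat n (f x)).
split=> [x|j].
  apply: (@differentiable_comp _ _ _ _ f (flat n)); first exact: Cf.1.
  by apply/derivable1_diffP; case: (is_derive_flat n (f x)).
rewrite (_ : 'D_('e_j) _ = fun x =>
  (flat n.+2 (f x) - n%:R * flat n.+1 (f x)) * 'D_('e_j) f x).
  apply: Ck_mul; last exact: Cf.2.
  apply: Ck_add; first exact/IH/Ck_leS.
  by apply/Ck_opp/Ck_scale/IH/Ck_leS.
apply/funext => x; apply: (@derive_val _ _ _ _ _ (fun x => flat n (f x))).
exact/is_derive_flat_comp/Cf.1.
Qed.

End SmoothClosure.

(** * Derivative bounds along lines *)

Section DerivativeBounds.
Variable R : realType.
Implicit Types (f g h q : R -> R) (A B C : R).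

(* |h^(i)| <= C A^i for all i <= n *)
Fixpoint geom_bounded A n C h : Prop :=
  (forall t, `|h t| <= C) /\
  if n is n'.+1 then
    exists2 h' : R -> R, (forall t : R, is_derive t 1 h (h' t)) & geom_bounded A n' (C * A) h'
  else True.

(** Only the top derivative is bounded, because the quadratic part of the hard function has
    unbounded values and slopes; products are handled with [geom_bounded]. *)
Fixpoint derive_bounded n C h : Prop :=
  if n is n'.+1 then
    exists2 h' : R -> R, (forall t : R, is_derive t 1 h (h' t)) & derive_bounded n' C h'
  else forall t, `|h t| <= C.

Lemma geom_bounded_le A n C B C' h : 0 <= A <= B -> 0 <= C <= C' ->
  geom_bounded A n C h -> geom_bounded B n C' h.
Proof.
move=> /andP[A0 AB]; elim: n C C' h => [|n IH] C C' h /andP[C0 CC'] /= [hC h'].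
  by split=> // t; exact: le_trans (hC t) CC'.
split=> [t|]; first exact: le_trans (hC t) CC'.
have [k dk hk] := h'; exists k => //; apply: IH hk.
by rewrite mulr_ge0//= ler_pM.
Qed.

Lemma geom_bounded_pred A n C h : geom_bounded A n.+1 C h -> geom_bounded A n C h.
Proof.
elim: n C h => [|n IH] C h [hC [k dk hk]] //.
by split=> //; exists k => //; exact: IH.
Qed.

Lemma geom_bounded_add A n C C' f g :
  geom_bounded A n C f -> geom_bounded A n C' g ->
  geom_bounded A n (C + C') (fun t => f t + g t).
Proof.
elim: n C C' f g => [|n IH] C C' f g [fC f'] [gC g'].
  by split=> // t; rewrite (le_trans (ler_normD _ _))// lerD.
split=> [t|]; first by rewrite (le_trans (ler_normD _ _))// lerD.
have [f1 df f1C] := f'; have [g1 dg g1C] := g'.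
exists (fun t => f1 t + g1 t) => [t|]; first exact: is_derive_addf.
by rewrite mulrDl; exact: IH.
Qed.

Lemma geom_bounded_scale A n C c f :
  geom_bounded A n C f -> geom_bounded A n (`|c| * C) (fun t => c * f t).
Proof.
elim: n C f => [|n IH] C f [fC f'].
  by split=> // t; rewrite normrM ler_wpM2l.
split=> [t|]; first by rewrite normrM ler_wpM2l.
have [f1 df f1C] := f'; exists (fun t => c * f1 t) => [t|]; first exact: is_derive_scalef.
by rewrite -mulrA; exact: IH.
Qed.

(** As in the binomial formula, the rates add: the product rule gives two products of the same kind,
    with constants [C * A * C'] and [C * (C' * B)]. *)
Lemma geom_bounded_mul A B n C C' f g : 0 <= A -> 0 <= B -> 0 <= C -> 0 <= C' ->
  geom_bounded A n C f -> geom_bounded B n C' g ->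
  geom_bounded (A + B) n (C * C') (fun t => f t * g t).
Proof.
move=> A0 B0; elim: n C C' f g => [|n IH] C C' f g C0 C'0 fb gb.
  by case: fb gb => fC _ [gC _]; split=> // t; rewrite normrM ler_pM.
have [[fC [f1 df f1C]] [gC [g1 dg g1C]]] := (fb, gb).
split=> [t|]; first by rewrite normrM ler_pM.
exists (fun t => f1 t * g t + f t * g1 t) => [t|]; first exact: is_derive_mulf.
have -> : C * C' * (A + B) = C * A * C' + C * (C' * B) by ring.
by apply: geom_bounded_add; apply: IH => //;
  rewrite ?mulr_ge0//; exact: geom_bounded_pred.
Qed.

(** For quadratic [Q], combinations of the functions [flat k (Q t) * q t ^+ i] are closed under
    differentiation. One derivative either adds a factor [q], at a cost of at most [a * (1 + N)], or
    replaces a factor [q] by [b], at a cost of at most [w * N]. The conditions on [N] dominate all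
    orders and exponents that occur. A bound on [q] where [Q] is positive suffices, as [flat]
    vanishes elsewhere. *)
Lemma geom_bounded_flat (N n k i : nat) (w a b : R) (Q q : R -> R) :
  0 <= w -> 0 <= a -> `|b| <= w * a ->
  (forall t : R, is_derive t 1 Q (q t)) -> (forall t : R, is_derive t 1 q b) ->
  (forall t, 0 < Q t -> `|q t| <= a) ->
  (k + 2 * n <= N)%N -> (i + n <= N)%N -> (0 < N)%N ->
  geom_bounded (a * (1 + N%:R) + w * N%:R) n (N%:R ^+ N * a ^+ i)
    (fun t => flat k (Q t) * q t ^+ i).
Proof.
move=> w0 a0 ba dQ dq qa + + N0.
have a'0 j : 0 <= a ^+ j by exact: exprn_ge0.
have N1 : 1 <= N%:R :> R by rewrite ler1n.
have base j l : (j <= N)%N -> forall t, `|flat j (Q t) * q t ^+ l| <= N%:R ^+ N * a ^+ l.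
  move=> jN t; have [Q0|Q0] := ltP 0 (Q t); last first.
    by rewrite flat_le0// mul0r normr0 mulr_ge0// exprn_ge0// ler0n.
  rewrite normrM normrX ler_pM ?normr_ge0 ?exprn_ge0//; last first.
    by rewrite lerXn2r ?nnegrE//; exact: qa.
  rewrite ger0_norm ?flat_ge0// (le_trans (flat_le _ _))//.
  apply: (@le_trans _ _ (N%:R ^+ j)); first by rewrite lerXn2r ?nnegrE ?ler0n ?ler_nat.
  by rewrite ler_weXn2l.
elim: n k i => [|n IH] k i kN iN.
  by split=> //; apply: base; rewrite muln0 addn0 in kN.
split; first by apply: base; exact: leq_trans (leq_addr _ _) kN.
pose F j l := fun t => flat j (Q t) * q t ^+ l.
exists (fun t => F k.+2 i.+1 t + - k%:R * F k.+1 i.+1 t + i%:R * b * F k i.-1 t).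
  move=> t; have dX : is_derive t 1 (fun s => q s ^+ i) (i%:R * q t ^+ i.-1 * b).
    have := @is_deriveX R R q i t 1 _ (dq t).
    by rewrite exprfctE.
  apply: (is_derive_eq (is_derive_mulf (is_derive_compf (is_derive_flat k (Q t)) (dQ t)) dX)).
  rewrite /F exprS; ring.
set G := N%:R ^+ N.
have G0 : 0 <= G by rewrite exprn_ge0// ler0n.
have A0 : 0 <= a * (1 + N%:R) + w * N%:R.
  by rewrite addr_ge0// mulr_ge0// ?addr_ge0 ?ler0n.
apply: (@geom_bounded_le (a * (1 + N%:R) + w * N%:R) _
  (G * a ^+ i.+1 + `|- k%:R| * (G * a ^+ i.+1) +
    `|i%:R * b| * (G * a ^+ i.-1))).
- by rewrite A0 lexx.
- rewrite !addr_ge0 ?mulr_ge0//= normrN normrM !(ger0_norm (ler0n _ _)).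
  have -> : G * a ^+ i * (a * (1 + N%:R) + w * N%:R) =
     G * a ^+ i.+1 + N%:R * (G * a ^+ i.+1) + N%:R * (w * (G * a ^+ i)).
    by rewrite exprS; ring.
  rewrite !lerD//.
    rewrite ler_wpM2r ?mulr_ge0// ler_nat.
    exact: leq_trans (leq_addr _ _) kN.
  (* For i = 0 the term with [b] vanishes; otherwise [|b| <= w * a] restores the power of [a] lost
     with the factor [q]. *)
  case: i {IH} iN => [|i] iN; first by rewrite !mul0r mulr_ge0// ?ler0n// !mulr_ge0.
  rewrite -mulrA ler_pM ?ler0n ?mulr_ge0 ?ler_nat//.
    exact: leq_trans (leq_addr _ _) iN.
  rewrite /= exprS (mulrCA _ G) [leRHS]mulrCA ler_wpM2l// mulrA.
  by rewrite ler_wpM2r.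
have step m : (i + n.+1 <= N -> m <= i.+1 -> m + n <= N)%N.
  by move=> iN' mi; apply: leq_trans iN'; rewrite addnS -addSn leq_add2r.
apply: geom_bounded_add.
  apply: geom_bounded_add.
    by apply: IH; [rewrite mulnS addnA addn2 in kN | exact: step].
  apply: geom_bounded_scale; apply: IH; last exact: step.
  by apply: leq_trans kN; rewrite mulnS addnA addn2 leq_add2r.
apply: geom_bounded_scale; apply: IH; last by apply: step => //; rewrite (leq_trans (leq_pred _)).
by apply: leq_trans kN; rewrite leq_add2l leq_mul2l leqnSn.
Qed.

Lemma derive_bounded_geom A n C h :
  geom_bounded A n C h -> derive_bounded n (C * A ^+ n) h.
Proof.
elim: n C h => [|n IH] C h; first by rewrite expr0 mulr1 => -[].
by case=> _ [k dk hk]; exists k => //; rewrite exprS mulrA; exact: IH.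
Qed.

Lemma derive_bounded_le n C C' h : C <= C' ->
  derive_bounded n C h -> derive_bounded n C' h.
Proof.
move=> CC'; elim: n h => [|n IH] h.
  by move=> hC t; exact: le_trans (hC t) CC'.
by case=> k dk hk; exists k => //; exact: IH.
Qed.

Lemma derive_bounded_add n C C' f g :
  derive_bounded n C f -> derive_bounded n C' g ->
  derive_bounded n (C + C') (fun t => f t + g t).
Proof.
elim: n f g => [|n IH] f g.
  by move=> fC gC t; rewrite (le_trans (ler_normD _ _))// lerD.
move=> [f1 df f1C] [g1 dg g1C].
exists (fun t => f1 t + g1 t) => [t|]; [exact: is_derive_addf|exact: IH].
Qed.

Lemma derive_bounded_scale n C c f :
  derive_bounded n C f -> derive_bounded n (`|c| * C) (fun t => c * f t).
Proof.
elim: n f => [|n IH] f; first by move=> fC t; rewrite normrM ler_wpM2l.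
move=> [f1 df f1C].
exists (fun t => c * f1 t) => [t|]; [exact: is_derive_scalef|exact: IH].
Qed.

Lemma derive_bounded_cst n (c : R) : derive_bounded n.+1 0 (fun=> c).
Proof.
elim: n c => [|n IH] c; exists (fun=> 0) => [t|];
  do ?by [exact: (is_derive_cst c)|exact: IH].
by move=> t; rewrite normr0.
Qed.

Lemma derive_bounded_sum n (I : Type) (r : seq I) (P : pred I) (F : I -> R -> R)
    (C : I -> R) : (forall i, P i -> derive_bounded n (C i) (F i)) ->
  derive_bounded n (\sum_(i <- r | P i) C i) (fun t => \sum_(i <- r | P i) F i t).
Proof.
move=> CF; elim: r => [|i r IH].
  rewrite big_nil (_ : (fun _ => _) = fun=> 0); last first.
    by apply/funext => x; rewrite big_nil.
  case: n {CF} => [|n]; last exact: derive_bounded_cst.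
  by move=> t; rewrite normr0.
rewrite big_cons (_ : (fun _ => _) =
    (fun y => if P i then F i y + \sum_(j <- r | P j) F j y
              else \sum_(j <- r | P j) F j y)); last first.
  by apply/funext => y; rewrite big_cons.
by case: ifP => // /CF CFi; exact: derive_bounded_add.
Qed.

Lemma derive_bounded_quadratic n (b : R) (Q q : R -> R) :
  (forall t : R, is_derive t 1 Q (q t)) -> (forall t : R, is_derive t 1 q b) ->
  derive_bounded n.+2 (if n is 0 then `|b| else 0) Q.
Proof.
move=> dQ dq; exists q => //; exists (fun=> b) => //.
by case: n => [//|n]; exact: derive_bounded_cst.
Qed.

(** This is the mean value theorem for the n-th derivative. *)
Lemma derive_bounded_lipschitz n C h : derive_bounded n.+1 C h ->
  forall t t', `|derive1n n h t - derive1n n h t'| <= C * `|t - t'|.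
Proof.
elim: n h => [|n IH] h [k dk kC]; last first.
  rewrite derive1Sn (_ : h^`()%classic = k); first exact: IH.
  by apply/funext => t; rewrite derive1E derive_val.
suff lt_case t t' : t < t' -> `|h t' - h t| <= C * `|t' - t|.
  move=> t t' /=; case: (ltgtP t t') => [tt'|tt'|->].
  - by rewrite distrC [`|t - t'|]distrC lt_case.
  - exact: lt_case.
  - by rewrite !subrr normr0 mulr0.
move=> tt'.
have ch : {within `[t, t'], continuous h}.
  apply: continuous_subspaceT => x; apply: differentiable_continuous.
  exact/derivable1_diffP.
have [c _ ->] := MVT tt' (fun x _ => dk x) ch.
by rewrite normrM ler_wpM2r.
Qed.

End DerivativeBounds.

(** The nonnegative sum of the [(B * a i - S * b i) ^+ 2] equals [B * (A * B - S ^+ 2)]; if [B] is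
    0, all the [b i] vanish. *)
Lemma cauchy_schwarz_sum (R : realType) (I : finType) (P : pred I) (a b : I -> R) :
  (\sum_(i | P i) a i * b i) ^+ 2 <=
  (\sum_(i | P i) a i ^+ 2) * (\sum_(i | P i) b i ^+ 2).
Proof.
set A := \sum_(i | P i) a i ^+ 2; set B := \sum_(i | P i) b i ^+ 2.
set S := \sum_(i | P i) a i * b i.
have B0 : 0 <= B by apply: sumr_ge0 => i _; exact: sqr_ge0.
have : 0 <= \sum_(i | P i) (B * a i - S * b i) ^+ 2.
  by apply: sumr_ge0 => i _; exact: sqr_ge0.
have -> : \sum_(i | P i) (B * a i - S * b i) ^+ 2 = B * (A * B - S ^+ 2).
  have expand u v : \sum_(i | P i) (u * a i - v * b i) ^+ 2 =
      u ^+ 2 * A - 2 * u * v * S + v ^+ 2 * B.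
    rewrite !mulr_sumr -sumrB -big_split /=.
    by apply: eq_bigr => i _; ring.
  by rewrite expand; ring.
move: B0; rewrite le_eqVlt => /predU1P[B0 _|B0]; last first.
  by rewrite pmulr_rge0// subr_ge0.
have b0 i : P i -> b i = 0.
  move=> Pi; apply/eqP; rewrite -sqrf_eq0.
  have := @psumr_eq0P _ _ P (fun i => b i ^+ 2) (fun i _ => sqr_ge0 _) (esym B0) i Pi.
  by move=> /= ->.
rewrite /S big1 => [|i Pi]; last by rewrite b0// mulr0.
by rewrite expr0n/= mulr_ge0// sumr_ge0// => i _; exact: sqr_ge0.
Qed.

(** * Squared distances along lines and the bumps built on them *)

Section SquaredDistance.
Variables (R : realType) (d : nat).
Implicit Types (P : pred 'I_d) (rho : R) (c : 'I_d -> R) (x v : 'rV[R]_d).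

Lemma enorm_sqrE x : enorm x ^+ 2 = \sum_j x 0 j ^+ 2.
Proof. by rewrite sqr_sqrtr// sumr_ge0// => j _; exact: sqr_ge0. Qed.

(** The common shape of the block distances, of the spike distance and, with center 0, of the
    quadratic regularizer. *)
Definition sqdist P rho c x : R := \sum_(j | P j) (x 0 j / rho - c j) ^+ 2.

Lemma sqdist_ge0 P rho c x : 0 <= sqdist P rho c x.
Proof. by apply: sumr_ge0 => j _; exact: sqr_ge0. Qed.

Lemma Ck_sqdist k P rho c : Ck k (sqdist P rho c).
Proof.
apply: Ck_sum => j _.
have Cj : Ck k (fun x : 'rV[R]_d => x 0 j / rho - c j).
  apply: (@Ck_add _ _ _ (fun x => x 0 j / rho) (fun=> - c j)); last exact: Ck_cst.
  by apply: (@Ck_mul _ _ _ (fun x => x 0 j)); [exact: Ck_coord | exact: Ck_cst].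
exact: (Ck_mul Cj Cj).
Qed.

Lemma is_derive_sqdist P rho c x v :
  is_derive x v (sqdist P rho c)
    (\sum_(j | P j) 2 * (x 0 j / rho - c j) * (v 0 j / rho)).
Proof.
apply: is_derive_sumf => j _.
have dj : is_derive x v (fun x : 'rV[R]_d => x 0 j / rho - c j) (v 0 j / rho).
  apply: (is_derive_eq (is_derive_addf (is_derive_mulf (is_derive_coord j x v)
    (is_derive_cst (rho^-1 : R) x v)) (is_derive_cst (- c j : R) x v))).
  by rewrite mulr0 !addr0.
apply: (is_derive_eq (is_derive_mulf dj dj)); ring.
Qed.

Lemma is_derive_sqdist_line P rho c x v (t : R) :
  is_derive t 1 (fun s : R => sqdist P rho c (x + s *: v))
    (\sum_(j | P j) 2 * ((x + t *: v) 0 j / rho - c j) * (v 0 j / rho)).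
Proof.
apply: is_derive_sumf => j _.
have dj : is_derive t (1 : R) (fun s : R => (x + s *: v) 0 j / rho - c j) (v 0 j / rho).
  rewrite (_ : (fun _ => _) = (fun s : R => v 0 j / rho * s + (x 0 j / rho - c j))).
    apply: (is_derive_eq (is_derive_addf (is_derive_scalef (v 0 j / rho) (is_derive_id t 1))
       (is_derive_cst (x 0 j / rho - c j : R) t 1))).
    by rewrite addr0 mulr1.
  by apply/funext => s; rewrite !mxE; ring.
apply: (is_derive_eq (is_derive_mulf dj dj)); ring.
Qed.

Lemma is_derive2_sqdist_line P rho c x v (t : R) :
  is_derive t 1
    (fun s : R => \sum_(j | P j) 2 * ((x + s *: v) 0 j / rho - c j) * (v 0 j / rho))
    (2 * \sum_(j | P j) (v 0 j / rho) ^+ 2).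
Proof.
rewrite mulr_sumr; apply: is_derive_sumf => j _.
rewrite (_ : (fun _ => _) = (fun s : R => 2 * (v 0 j / rho) ^+ 2 * s +
   2 * (x 0 j / rho - c j) * (v 0 j / rho))).
  apply: (is_derive_eq (is_derive_addf
       (is_derive_scalef (2 * (v 0 j / rho) ^+ 2) (is_derive_id t 1))
       (is_derive_cst (2 * (x 0 j / rho - c j) * (v 0 j / rho) : R) t 1))).
  by rewrite addr0 mulr1.
by apply/funext => s; rewrite !mxE; ring.
Qed.

(** Where the bump is nonzero the squared distance is below 5, so by Cauchy-Schwarz its derivative
    along the line is at most 2 sqrt 5 w <= 5 w; its second derivative is at most 2 w^2. Hence
    [geom_bounded_flat] applies with [a = 5 * w]. *)
Lemma geom_bounded_bump (N n : nat) (h w : R) P rho c x v :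
  0 <= w -> \sum_(j | P j) (v 0 j / rho) ^+ 2 <= w ^+ 2 -> h <= 5 ->
  (2 * n <= N)%N -> (0 < N)%N ->
  geom_bounded (w * (5 + 6 * N%:R)) n (N%:R ^+ N)
    (fun t : R => flat 0 (h - sqdist P rho c (x + t *: v))).
Proof.
move=> w0 vw h5 nN N0.
pose Q t : R := h - sqdist P rho c (x + t *: v).
pose q t : R := - \sum_(j | P j) 2 * ((x + t *: v) 0 j / rho - c j) * (v 0 j / rho).
pose b : R := - (2 * \sum_(j | P j) (v 0 j / rho) ^+ 2).
have dQ (t : R) : is_derive t 1 Q (q t).
  apply: (is_derive_eq (is_derive_addf (is_derive_cst (h : R) t 1)
    (is_derive_oppf (is_derive_sqdist_line P rho c x v t)))).
  by rewrite add0r.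
have dq (t : R) : is_derive t 1 q b by exact/is_derive_oppf/is_derive2_sqdist_line.
have V0 : 0 <= \sum_(j | P j) (v 0 j / rho) ^+ 2.
  by apply: sumr_ge0 => j _; exact: sqr_ge0.
have bw : `|b| <= w * (5 * w).
  rewrite normrN ger0_norm ?mulr_ge0//.
  apply: (@le_trans _ _ (2 * w ^+ 2)); first by rewrite ler_wpM2l.
  by have := sqr_ge0 w; rewrite expr2; lra.
have qa t : 0 < Q t -> `|q t| <= 5 * w.
  rewrite subr_gt0 => Qt; rewrite normrN.
  rewrite -(@ler_pXn2r _ 2) ?nnegrE ?mulr_ge0//.
  rewrite real_normK ?num_real//.
  have -> : \sum_(j | P j) 2 * ((x + t *: v) 0 j / rho - c j) * (v 0 j / rho) =
     2 * \sum_(j | P j) ((x + t *: v) 0 j / rho - c j) * (v 0 j / rho).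
    by rewrite mulr_sumr; apply: eq_bigr => j _; rewrite -!mulrA.
  rewrite exprMn; apply: (@le_trans _ _ (2 ^+ 2 * (5 * w ^+ 2))).
    rewrite ler_wpM2l ?sqr_ge0//; apply: le_trans (cauchy_schwarz_sum _ _ _) _.
    by rewrite ler_pM ?sqdist_ge0// (le_trans (ltW Qt)).
  by have := sqr_ge0 w; rewrite exprMn; lra.
have := @geom_bounded_flat _ N n 0 0 w (5 * w) b Q q w0 (mulr_ge0 (ler0n _ 5) w0)
  bw dQ dq qa nN (leq_trans _ nN) N0.
rewrite expr0 mulr1.
have -> : 5 * w * (1 + N%:R) + w * N%:R = w * (5 + 6 * N%:R) by ring.
have -> : (fun t => flat 0 (Q t) * q t ^+ 0) = (fun t => flat 0 (Q t)).
  by apply/funext => t; rewrite expr0 mulr1.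
by apply; rewrite add0n leq_pmull.
Qed.

End SquaredDistance.

(** * The hard function *)

(** Jets are local: an answer reveals the function only near the query. *)
Lemma partials_near_eq (R : realType) (d : nat) (s : seq 'I_d)
    (f g : 'rV[R]_d -> R) (x : 'rV[R]_d) :
  (\forall y \near x, f y = g y) -> partials s f x = partials s g x.
Proof.
(* The induction carries equality on a neighbourhood, since equality at [x] alone says nothing about
   derivatives. *)
move=> fg; apply: (@nbhs_singleton _ x (fun y => partials s f y = partials s g y)).
elim: s => [|j s IH] //=.
move/nbhs_interior: IH; apply: filterS => y IHy.
exact: near_eq_derive.
Qed.

Section HardFunction.
Variables (R : realType) (d m T : nat) (s rho a H : R).
Implicit Types (sg : {ffun 'I_d -> bool}) (x v : 'rV[R]_d).

Definition blk (j : 'I_d) : nat := (j %/ m)%N.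

Definition unit_dir sg (j : 'I_d) : R := (-1) ^+ sg j / Num.sqrt m%:R.

(** The extension by 0 makes the spike confine all coordinates, not only those of block [T]. *)
Definition spike_center sg (j : 'I_d) : R := if blk j == T then unit_dir sg j else 0.

Definition block_dist sg (b : nat) x : R := sqdist [pred j | blk j == b] s (unit_dir sg) x.

Definition spike_dist sg x : R := sqdist predT rho (spike_center sg) x.

Definition gate sg (b : nat) x : R := flat 0 (4^-1 - block_dist sg b x).

Definition link sg (b : nat) x : R :=
  (if b is b'.+1 then gate sg b' x else 1) * flat 0 (5 - block_dist sg b x).

(** Chosen so that [6 * beta] is 2 expR (- 8) expR (- 1) / 25, the lower bound for the pull of an
    active link in [grad_hard_ge]. *)
Definition beta : R := expR (- 9) / 75.

(** The quadratic leaves out block [T], so that it vanishes at the center of the spike. Truncation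
    at [k] links describes what an early query can see. *)
Definition chain sg (k : nat) x : R :=
  a * (beta / 2 * sqdist [pred j | (blk j < T)%N] s (fun=> 0) x
       - \sum_(b < k) link sg b x).

Definition spike sg x : R := flat 0 (4^-1 - spike_dist sg x).

Definition hard sg x : R := chain sg T x - H * spike sg x.

Lemma Ck_flat_sqdist k P r c h : @Ck R d k (fun x => flat 0 (h - sqdist P r c x)).
Proof.
apply: Ck_flat; apply: (@Ck_add _ _ _ (fun=> h)); first exact: Ck_cst.
exact/Ck_opp/Ck_sqdist.
Qed.

Lemma Cinfty_link sg b : Cinfty (link sg b).
Proof.
have Cb (h : R) c k : Ck k (fun x => flat 0 (h - block_dist sg c x)).
  exact: Ck_flat_sqdist.
by case: b => [|b] k; apply: Ck_mul; do ?[exact: Cb|exact: Ck_cst].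
Qed.

Lemma Cinfty_chain sg k : Cinfty (chain sg k).
Proof.
move=> n; apply: Ck_scale; apply: Ck_add; first exact/Ck_scale/Ck_sqdist.
apply/Ck_opp/Ck_sum => b _; exact: Cinfty_link.
Qed.

Lemma Cinfty_hard sg : Cinfty (hard sg).
Proof.
move=> n; apply: Ck_add; first exact: Cinfty_chain.
exact/Ck_opp/Ck_scale/Ck_flat_sqdist.
Qed.

Lemma flat_near0 P r c (x : 'rV[R]_d) (h : R) : h < sqdist P r c x ->
  \forall y \near x, flat 0 (h - sqdist P r c y) = 0.
Proof.
move=> hx; have cont : continuous (sqdist P r c) := Ck_sqdist 0 P r c.
have : \forall y \near x, h < sqdist P r c y by exact: cont x _ (lt_nbhsr hx).
by apply: filterS => y hy; rewrite flat_le0// subr_le0 ltW.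
Qed.

(** A link b > k carries the gate of block b - 1 >= k, which vanishes near [x], as does the spike.
    Link [k] survives and may expose the signs of block [k]. *)
Lemma hard_near_chain sg k x : (k < T)%N ->
  (forall b, (k <= b < T)%N -> 4^-1 < block_dist sg b x) -> 4^-1 < spike_dist sg x ->
  \forall y \near x, hard sg y = chain sg k.+1 y.
Proof.
move=> kT far tfar.
have spike0 : \forall y \near x, spike sg y = 0 by exact: flat_near0.
have gate0 : \forall y \near x, forall b : 'I_T, (k <= b)%N -> gate sg b y = 0.
  apply: (@filter_forall _ _
    (fun (b : 'I_T) y => (k <= b)%N -> gate sg b y = 0) (nbhs x) _) => b.
  have [kb|bk] := leqP k b; last exact: nearW.
  have fb : 4^-1 < block_dist sg b x by rewrite far// kb ltn_ord.
  by have := flat_near0 fb; apply: filterS => y yb _; exact: yb.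
near=> y.
have b0 : spike sg y = 0 by near: y.
have g0 : forall b : 'I_T, (k <= b)%N -> gate sg b y = 0 by near: y.
rewrite /hard b0 mulr0 subr0 /chain; congr (a * (_ - _)).
rewrite -!(big_mkord xpredT (fun b => link sg b y)).
rewrite (@big_cat_nat _ _ _ k.+1)//= [\sum_(k.+1 <= _ < T) _]big_nat.
rewrite [X in _ + X]big1 ?addr0// => -[//|b] /andP[kb bT].
by rewrite /link (g0 (Ordinal (ltnW bT)))// mul0r.
Unshelve. all: by end_near. Qed.

Lemma link_ge0 sg b x : 0 <= link sg b x.
Proof. by case: b => [|b]; rewrite mulr_ge0// flat_ge0. Qed.

Lemma link_le1 sg b x : link sg b x <= 1.
Proof.
by case: b => [|b]; rewrite /link ?mul1r ?mulr_ile1 ?flat_ge0 ?flat0_le1.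
Qed.

Lemma beta_gt0 : 0 < beta.
Proof. by rewrite divr_gt0// expR_gt0. Qed.

Lemma chain_ge sg k x : 0 <= a -> - (a * k%:R) <= chain sg k x.
Proof.
move=> a0; rewrite -mulrN ler_wpM2l//.
have : \sum_(b < k) link sg b x <= k%:R.
  rewrite -[leRHS]mulr1 mulr_natl -[k in leRHS]card_ord -sumr_const ler_sum// => b _.
  exact: link_le1.
have : 0 <= beta / 2 * sqdist [pred j | (blk j < T)%N] s (fun=> 0) x.
  by rewrite mulr_ge0 ?sqdist_ge0// divr_ge0// ltW// beta_gt0.
lra.
Qed.

(** Link [b] involves the signs of blocks b - 1 and b only, and the quadratic none. *)
Lemma chain_eq_signs sg sg' k : (forall j, (blk j < k)%N -> sg j = sg' j) ->
  chain sg k = chain sg' k.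
Proof.
move=> e; apply/funext => x; congr (a * (_ - _)); apply: eq_bigr => b _.
have bd c : (c < k)%N -> block_dist sg c x = block_dist sg' c x.
  move=> ck; apply: eq_bigr => j /eqP bj.
  by rewrite /unit_dir e// bj.
case: b => -[|b] bk /=; rewrite /link /gate !bd//; exact: ltnW.
Qed.

End HardFunction.

(** * Dimension-free smoothness of the hard function *)

Lemma sum_fibers_le (R : realType) (I : finType) (n : nat) (g : I -> nat) (F : I -> R) :
  (forall j, 0 <= F j) ->
  \sum_(b < n) \sum_(j | g j == b) F j <= \sum_j F j.
Proof.
move=> F0; rewrite (exchange_big_dep predT)//=; apply: ler_sum => j _.
have [gn|gn] := ltnP (g j) n.
  rewrite (big_pred1 (Ordinal gn))// => b; by rewrite eq_sym.
rewrite big_pred0// => b; apply/negbTE; apply: contraTN gn => /eqP ->.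
by rewrite -ltnNge.
Qed.

(** With N = 2 n, the summand 1 pays for the quadratic. In the other one, a link is a product of two
    bumps, whence the square of N^N and the doubled rate 2 (5 + 6 N); the factor 2 arises as each
    block occurs in two links. *)
Definition smoothness_const (R : realType) (n : nat) : R :=
  1 + 2 * ((2 * n)%:R ^+ (2 * n)) ^+ 2 * (10 + 12 * (2 * n)%:R) ^+ n.

Section HardFunctionSmoothness.
Variables (R : realType) (d m T : nat) (s rho a H : R).
Hypotheses (s0 : 0 < s) (rho0 : 0 < rho) (a0 : 0 <= a) (H0 : 0 <= H).
Implicit Types (sg : {ffun 'I_d -> bool}) (x v : 'rV[R]_d).

(** These are the blocks on which link [b] depends; testing the successor leaves only block 0 when b
    = 0. *)
Definition block_mass (b : nat) v : R :=
  \sum_(j | (blk m j == b) || ((blk m j).+1 == b)) v 0 j ^+ 2.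

Lemma block_mass_ge0 b v : 0 <= block_mass b v.
Proof. by apply: sumr_ge0 => j _; exact: sqr_ge0. Qed.

Lemma sum_block_mass_le v : \sum_(b < T) block_mass b v <= 2 * \sum_j v 0 j ^+ 2.
Proof.
have F0 (j : 'I_d) : 0 <= v 0 j ^+ 2 by exact: sqr_ge0.
rewrite mulr_natl mulr2n.
apply: (@le_trans _ _ (\sum_(b < T) \sum_(j | blk m j == b) v 0 j ^+ 2 +
    \sum_(b < T) \sum_(j | (blk m j).+1 == b) v 0 j ^+ 2)).
  rewrite -big_split/=; apply: ler_sum => b _.
  rewrite /block_mass 2!(big_mkcond (fun j => _ == _)) -big_split big_mkcond/=.
  apply: ler_sum => j _; have := F0 j.
  by case: (blk m j == b); case: ((blk m j).+1 == b) => /=; lra.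
by apply: lerD; [exact: (sum_fibers_le _ (blk m))|exact: (sum_fibers_le _ (fun j => (blk m j).+1))].
Qed.

Lemma sum_div_sqr (P : pred 'I_d) r v :
  \sum_(j | P j) (v 0 j / r) ^+ 2 = (\sum_(j | P j) v 0 j ^+ 2) / r ^+ 2.
Proof. by rewrite mulr_suml; apply: eq_bigr => j _; rewrite expr_div_n. Qed.

Lemma sum_sub_le (P Q : pred 'I_d) v : subpred P Q ->
  \sum_(j | P j) v 0 j ^+ 2 <= \sum_(j | Q j) v 0 j ^+ 2.
Proof.
move=> PQ; rewrite big_mkcond [leRHS]big_mkcond; apply: ler_sum => j _.
by case: ifP => [/PQ ->//|_]; case: ifP => // _; exact: sqr_ge0.
Qed.

(* The weight of the two blocks enters with the power n >= 2, so that the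
   bounds of all the links sum up to a quantity independent of T. *)
Lemma derive_bounded_link sg b x v n : (0 < n)%N ->
  derive_bounded n (((2 * n)%:R ^+ (2 * n)) ^+ 2 *
     (Num.sqrt (block_mass b v) / s * (10 + 12 * (2 * n)%:R)) ^+ n)
    (fun t : R => link m s sg b (x + t *: v)).
Proof.
move=> n0; set N := (2 * n)%N; set w := _ / s.
have N0 : (0 < N)%N by rewrite muln_gt0.
have NN1 : 1 <= N%:R ^+ N :> R by rewrite exprn_ege1// ler1n.
have w0 : 0 <= w by rewrite divr_ge0 ?sqrtr_ge0// ltW.
have r0 : 0 <= w * (5 + 6 * N%:R) by rewrite mulr_ge0// addr_ge0// mulr_ge0// ler0n.
have bump_bounded h c : h <= 5 -> (c == b) || (c.+1 == b) ->
    geom_bounded (w * (5 + 6 * N%:R)) n (N%:R ^+ N)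
      (fun t : R => flat 0 (h - block_dist m s sg c (x + t *: v))).
  move=> h5 cb; apply: geom_bounded_bump => //.
  rewrite sum_div_sqr expr_div_n sqr_sqrtr ?block_mass_ge0//.
  rewrite ler_wpM2r ?invr_ge0 ?sqr_ge0//; apply: sum_sub_le => j /= /eqP ->.
  by rewrite cb.
apply: derive_bounded_geom.
have -> : w * (10 + 12 * N%:R) = w * (5 + 6 * N%:R) + w * (5 + 6 * N%:R) by ring.
have q5 : 4^-1 <= 5 :> R by lra.
(* Link 0 is a single bump, and its better bound is weakened to the common one. *)
case: b @w w0 r0 bump_bounded => [|b] w w0 r0 bump_bounded.
  rewrite /link (_ : (fun _ => _) =
      (fun t : R => flat 0 (5 - block_dist m s sg 0 (x + t *: v)))).
    apply: (geom_bounded_le _ _ (bump_bounded 5 0%N _ _)) => //.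
      by rewrite r0 lerDl.
    by rewrite expr2 ler_peMr ?(le_trans ler01)//=.
  by apply/funext => t; rewrite mul1r.
rewrite /link expr2; apply: geom_bounded_mul => //; rewrite ?(le_trans ler01)//.
  by apply: (bump_bounded _ b) => //; rewrite eqxx orbT.
by apply: (bump_bounded _ b.+1) => //; rewrite eqxx.
Qed.

Lemma derive_bounded_chain sg k x v n : (k <= T)%N -> (1 < n)%N -> enorm v <= 1 ->
  derive_bounded n (a * smoothness_const R n / s ^+ n)
    (fun t : R => chain m T s a sg k (x + t *: v)).
Proof.
move=> kT n1 v1; have n0 : (0 < n)%N by exact: ltnW.
have v1' : \sum_j v 0 j ^+ 2 <= 1.
  by rewrite -enorm_sqrE exprn_ile1// sqrtr_ge0.
set C1 := ((2 * n)%:R ^+ (2 * n)) ^+ 2 : R; set C2 := 10 + 12 * (2 * n)%:R : R.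
have C10 : 0 <= C1 by exact: sqr_ge0.
have C20 : 0 <= C2 by rewrite addr_ge0// mulr_ge0// ler0n.
have links : derive_bounded n (2 * C1 * C2 ^+ n / s ^+ n)
    (fun t : R => \sum_(b < k) link m s sg b (x + t *: v)).
  have := @derive_bounded_sum R n 'I_k (index_enum _) xpredT _ _
    (fun b _ => derive_bounded_link sg b x v n0).
  apply: derive_bounded_le.
  have -> : 2 * C1 * C2 ^+ n / s ^+ n = C1 * (2 * (C2 ^+ n / s ^+ n)) by ring.
  rewrite -mulr_sumr -/C1 ler_wpM2l//.
  under eq_bigr do rewrite !exprMn exprVn -mulrA (mulrC (s ^- n)).
  rewrite -mulr_suml -/C2 ler_wpM2r ?mulr_ge0 ?invr_ge0 ?exprn_ge0 ?(ltW s0)//.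
  apply: (@le_trans _ _ (\sum_(b < T) block_mass b v)); last first.
    by apply: le_trans (sum_block_mass_le v) _; rewrite ler_piMr.
  rewrite (big_ord_widen _ (fun b => Num.sqrt (block_mass b v) ^+ n) kT).
  rewrite big_mkcond; apply: ler_sum => b _.
  case: ifP => _; last exact: block_mass_ge0.
  (* The mass is at most 1 and n >= 2, so the n-th power of its square root is at most the mass
     itself. *)
  rewrite -[leRHS]sqr_sqrtr ?block_mass_ge0//.
  apply: ler_wiXn2l => //.
  rewrite -sqrtr1 ler_wsqrtr//; apply: le_trans v1'.
  exact: (sum_sub_le (Q := predT)).
have reg : derive_bounded n (2 / s ^+ n)
   (fun t : R => sqdist [pred j | (blk m j < T)%N] s (fun=> 0) (x + t *: v)).
  have dQ := is_derive_sqdist_line [pred j | (blk m j < T)%N] s (fun=> 0) x v.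
  have dq := is_derive2_sqdist_line [pred j | (blk m j < T)%N] s (fun=> 0) x v.
  case: (n) n1 => [|[|n']] // _.
  apply: (derive_bounded_le _ (derive_bounded_quadratic n' dQ dq)).
  case: n' => [|n']; last by rewrite divr_ge0// exprn_ge0// ltW.
  rewrite sum_div_sqr ger0_norm; last first.
    by rewrite mulr_ge0// divr_ge0 ?sqr_ge0// sumr_ge0// => j _; exact: sqr_ge0.
  rewrite mulrA ler_wpM2r ?invr_ge0 ?sqr_ge0// ler_piMr//.
  apply: le_trans v1'; exact: (sum_sub_le (Q := predT)).
have beta0 : 0 <= beta R / 2 by rewrite divr_ge0// ltW// beta_gt0.
have beta1 : beta R / 2 * 2 <= 1.
  rewrite divfK ?pnatr_eq0// ler_pdivrMr// mul1r.
  apply: (@le_trans _ _ 1); last by rewrite ler1n.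
  by rewrite expR_le1 oppr_le0.
have := derive_bounded_scale a (derive_bounded_add
  (derive_bounded_scale (beta R / 2) reg) (derive_bounded_scale (-1) links)).
rewrite (_ : (fun t : R => a * _) = (fun t : R => chain m T s a sg k (x + t *: v))); last first.
  by apply/funext => t; rewrite mulN1r.
apply: derive_bounded_le.
rewrite (ger0_norm a0) -[leRHS]mulrA ler_wpM2l// normrN normr1 mul1r (ger0_norm beta0).
rewrite /smoothness_const -/C1 -/C2 [leRHS]mulrDl lerD// mul1r mulrA.
by rewrite ler_piMl// invr_ge0 exprn_ge0// ltW.
Qed.

Lemma derive_bounded_hard sg x v n : (1 < n)%N -> enorm v <= 1 ->
  derive_bounded n (a * smoothness_const R n / s ^+ n + H * smoothness_const R n / rho ^+ n)
    (fun t : R => hard m T s rho a H sg (x + t *: v)).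
Proof.
move=> n1 v1; have n0 : (0 < n)%N by exact: ltnW.
have v1' : \sum_j v 0 j ^+ 2 <= 1.
  by rewrite -enorm_sqrE exprn_ile1// sqrtr_ge0.
have N0 : (0 < 2 * n)%N by rewrite muln_gt0.
have spike_b : derive_bounded n (smoothness_const R n / rho ^+ n)
    (fun t : R => spike m T rho sg (x + t *: v)).
  (* The spike is one bump over all coordinates, with [w = rho^-1] because [enorm v <= 1]. *)
  have := @geom_bounded_bump R d (2 * n) n 4^-1 rho^-1 predT rho
    (spike_center R m T sg) x v.
  rewrite invr_ge0 (ltW rho0) sum_div_sqr exprVn ler_piMl ?invr_ge0 ?sqr_ge0//.
  have q5 : 4^-1 <= 5 :> R by lra.
  move=> /(_ isT isT q5 (leqnn _) N0)/derive_bounded_geom.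
  apply: derive_bounded_le.
  set M : R := (2 * n)%:R; set P := M ^+ (2 * n).
  have M0 : 0 <= M by exact: ler0n.
  have P1 : 1 <= P by rewrite exprn_ege1// ler1n.
  rewrite exprMn exprVn mulrCA mulrC ler_wpM2r ?invr_ge0 ?exprn_ge0 ?(ltW rho0)//.
  apply: (@le_trans _ _ (P * (10 + 12 * M) ^+ n)).
    rewrite ler_wpM2l ?(le_trans ler01)// lerXn2r ?nnegrE//; lra.
  rewrite /smoothness_const -/M -/P; set E := (10 + 12 * M) ^+ n.
  have E0 : 0 <= E by rewrite exprn_ge0//; lra.
  rewrite (@le_trans _ _ (2 * P ^+ 2 * E))//; last by rewrite lerDr.
  by rewrite ler_wpM2r// expr2; nra.
have := derive_bounded_add (derive_bounded_chain sg x (leqnn T) n1 v1)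
  (derive_bounded_scale (- H) spike_b).
rewrite (_ : (fun t : R => _ + _) = (fun t : R => hard m T s rho a H sg (x + t *: v))); last first.
  by apply/funext => t; rewrite mulNr.
by rewrite normrN (ger0_norm H0) mulrA.
Qed.

End HardFunctionSmoothness.

(** * Location of the minimizers *)

Section HardFunctionGeometry.
Variables (R : realType) (d m T : nat) (s rho a H : R).
Hypotheses (m0 : (0 < m)%N) (dimE : (T.+1 * m <= d)%N).
Hypotheses (s0 : 0 < s) (rho0 : 0 < rho) (a0 : 0 <= a) (H0 : 0 <= H).
Implicit Types (sg : {ffun 'I_d -> bool}) (x v : 'rV[R]_d).

Lemma card_block b : (b <= T)%N -> #|[pred j : 'I_d | blk m j == b]| = m.
Proof.
move=> bT; have lt_d (i : 'I_m) : (b * m + i < d)%N.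
  apply: leq_trans dimE; apply: (@leq_trans (b.+1 * m)); last by rewrite leq_mul2r ltnS bT orbT.
  by rewrite mulSn addnC ltn_add2r.
pose f (i : 'I_m) := Ordinal (lt_d i).
have f_inj : injective f.
  by move=> i j /(congr1 val) /= /addnI ij; exact: val_inj.
rewrite -[RHS]card_ord -(card_codom f_inj); apply: eq_card => j.
rewrite !inE /blk; apply/eqP/codomP => [jb|[i ->]]; last first.
  by rewrite /= divnMDl// divn_small// addn0.
exists (Ordinal (ltn_pmod j m0)); apply: val_inj => /=.
by rewrite -jb -divn_eq.
Qed.

Lemma unit_dir_sqr sg j : unit_dir R m sg j ^+ 2 = m%:R^-1.
Proof. by rewrite expr_div_n sqrr_sign sqr_sqrtr ?ler0n// mul1r. Qed.

Lemma sum_unit_dir_sqr sg b : (b <= T)%N ->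
  \sum_(j | blk m j == b) unit_dir R m sg j ^+ 2 = 1.
Proof.
move=> bT; under eq_bigr do rewrite unit_dir_sqr.
by rewrite sumr_const card_block// -[_ *+ m]mulr_natl divff// pnatr_eq0 -lt0n.
Qed.

(** For y = x / rho and the unit center u, |y|^2 <= 2 |y - u|^2 + 2 |u|^2 <= 5/2 <= 4. *)
Lemma enorm_spike_le sg x : spike_dist m T rho sg x <= 4^-1 -> enorm x <= 2 * rho.
Proof.
move=> xd; rewrite -(@ler_pXn2r _ 2) ?nnegrE ?sqrtr_ge0 ?mulr_ge0 ?(ltW rho0)// enorm_sqrE.
have c1 : \sum_j spike_center R m T sg j ^+ 2 = 1.
  rewrite -(sum_unit_dir_sqr sg (leqnn T)) [RHS]big_mkcond; apply: eq_bigr => j _.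
  by rewrite /spike_center; case: ifP => // _; rewrite expr0n.
have : \sum_j (x 0 j / rho) ^+ 2 <=
    2 * spike_dist m T rho sg x + 2 * \sum_j spike_center R m T sg j ^+ 2.
  rewrite !mulr_sumr -big_split; apply: ler_sum => j _ /=.
  have := sqr_ge0 (x 0 j / rho - 2 * spike_center R m T sg j).
  rewrite !expr2; lra.
under eq_bigr do rewrite expr_div_n.
rewrite c1 -mulr_suml ler_pdivrMr ?exprn_gt0// => /le_trans; apply.
by rewrite exprMn ler_wpM2r ?sqr_ge0//; lra.
Qed.

(** At the center of the spike the value is at most - H expR (- 4), while outside the ball [K] it is
    at least - a T. So minimization reduces to the compact set [K]. *)
Lemma argmin_hard sg : a * T%:R < H * expR (- 4) ->
  argmin (hard m T s rho a H sg) !=set0 /\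
  (forall x, argmin (hard m T s rho a H sg) x -> enorm x <= 2 * rho).
Proof.
move=> aH; set f := hard _ _ _ _ _ _ _.
pose x0 : 'rV[R]_d := \row_j (rho * spike_center R m T sg j).
pose K : set 'rV[R]_d := [set x | spike_dist m T rho sg x <= 4^-1].
have x0d : spike_dist m T rho sg x0 = 0.
  by apply: big1 => j _; rewrite mxE mulrC mulKf ?gt_eqF// subrr expr0n.
have fx0 : f x0 <= - (H * expR (- 4)).
  rewrite /f /hard /spike x0d subr0 /flat invr_gt0 ltr0n expr0 mul1r invrK.
  rewrite gerDr mulr_ge0_le0// subr_le0.
  rewrite [X in _ * X]big1 ?mulr0 ?sumr_ge0// => [b _|j /= jT]; first exact: link_ge0.
  by rewrite mxE /spike_center ifF ?mulr0 ?mul0r ?subr0 ?expr0n// ltn_eqF.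
have far x : ~ K x -> f x0 < f x.
  move/negP; rewrite /K /= -ltNge => xd; apply: (le_lt_trans fx0).
  rewrite /f /hard /spike flat_le0 ?subr_le0 ?(ltW xd)// mulr0 subr0.
  by apply: lt_le_trans (chain_ge _ _ _ _ _ _ a0); rewrite ltrN2.
split; last first.
  move=> x fx; apply: (@enorm_spike_le sg); have [//|/far] := pselect (K x).
  by rewrite ltNge fx.
have cK : compact K.
  apply: bounded_closed_compact; last first.
    have cont : continuous (spike_dist m T rho sg) := Ck_sqdist 0 _ _ _.
    apply: (@closed_comp _ _ (spike_dist m T rho sg) [set y | y <= 4^-1]); last exact: closed_le.
    by move=> x _; exact: cont.
  exists (2 * rho); split; first exact: num_real.
  move=> M rM x /enorm_spike_le xr; apply: le_trans (ltW rM).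
  (* The ambient norm is the sup norm, which [enorm] dominates. *)
  rewrite [leLHS]/Num.Def.normr /= mx_normrE.
  apply: bigmax_le => [|[i j] _]; first by rewrite mulr_ge0// ltW.
  apply: le_trans xr; rewrite /= ord1 -sqrtr_sqr ler_wsqrtr// (bigD1 j)//= lerDl.
  by apply: sumr_ge0 => k _; exact: sqr_ge0.
have cf : continuous f by exact: (Cinfty_hard m T s rho a H sg 0).
have [|c cK' fc] := @EVT_min_rV R d f K _ cK (continuous_subspaceT cf).
  by exists x0; rewrite /K /= x0d.
exists c => y; have [Ky|/far fy] := pselect (K y); first by apply: fc; rewrite inE.
by apply: le_trans (ltW fy); apply: fc; rewrite inE /K /= x0d.
Qed.

End HardFunctionGeometry.

(** * Lower bound for the gradient *)

Section HardFunctionGradient.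
Variables (R : realType) (d m T : nat) (s rho a H : R).
Hypotheses (m0 : (0 < m)%N) (dimE : (T.+1 * m <= d)%N).
Hypotheses (s0 : 0 < s) (a0 : 0 <= a).
Implicit Types (sg : {ffun 'I_d -> bool}) (x v : 'rV[R]_d).

Lemma is_derive_sqdist_unit (P : pred 'I_d) r c x (j : 'I_d) :
  is_derive x 'e_j (sqdist P r c)
    (if P j then 2 * (x 0 j / r - c j) / r else 0).
Proof.
apply: (is_derive_eq (is_derive_sqdist P r c x 'e_j)).
have e0 i : i != j -> ('e_j : 'rV[R]_d) 0 i = 0.
  by move=> ij; rewrite mxE eqxx (negbTE ij).
case: ifP => Pj.
  rewrite (bigD1 j)//= big1 => [|i /andP[_ /e0 ->]]; last by rewrite mul0r mulr0.
  by rewrite mxE !eqxx addr0 mul1r.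
rewrite big1// => i Pi; rewrite e0 ?mul0r ?mulr0//.
by apply: contraTN Pi => /eqP ->; rewrite Pj.
Qed.

Lemma is_derive_flat_sqdist_unit (P : pred 'I_d) r c h x (j : 'I_d) :
  is_derive x 'e_j (fun y => flat 0 (h - sqdist P r c y))
    (- ((P j)%:R * flat 2 (h - sqdist P r c x) * (2 * (x 0 j / r - c j) / r))).
Proof.
have dS := is_derive_sqdist_unit P r c x j.
have dH := is_derive_addf (is_derive_cst (h : R) x 'e_j) (is_derive_oppf dS).
have diffH : differentiable (fun y => h - sqdist P r c y) x.
  apply: (@Ck_differentiable _ _ 0); apply: (@Ck_add _ _ _ (fun=> h)); first exact: Ck_cst.
  exact/Ck_opp/Ck_sqdist.
apply: (is_derive_eq (is_derive_flat_comp 0 'e_j diffH)).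
rewrite mul0r subr0 (@derive_val _ _ _ _ _ _ _ dH) add0r mulrN.
by case: (P j); rewrite ?mulr0 ?mul0r ?mul1r.
Qed.

(* - coef b c is the factor of the gradient of link b with respect to block c
   in front of 2 (x - s u) / s^2. *)
Definition link_coef sg (b c : nat) x : R :=
  if b is b'.+1 then
    (c == b')%:R * flat 2 (4^-1 - block_dist m s sg b' x) * flat 0 (5 - block_dist m s sg b x)
    + gate m s sg b' x * ((c == b)%:R * flat 2 (5 - block_dist m s sg b x))
  else (c == b)%:R * flat 2 (5 - block_dist m s sg b x).

Lemma link_coef_ge0 sg b c x : 0 <= link_coef sg b c x.
Proof.
by case: b => [|b]; rewrite ?addr_ge0// ?mulr_ge0 ?flat_ge0 ?ler0n.
Qed.

Lemma is_derive_link sg b x (j : 'I_d) :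
  is_derive x 'e_j (link m s sg b)
    (- (link_coef sg b (blk m j) x * (2 * (x 0 j / s - unit_dir R m sg j) / s))).
Proof.
have dF h c : is_derive x 'e_j (fun y => flat 0 (h - block_dist m s sg c y))
    (- ((blk m j == c)%:R * flat 2 (h - block_dist m s sg c x) *
       (2 * (x 0 j / s - unit_dir R m sg j) / s))).
  exact: is_derive_flat_sqdist_unit.
case: b => [|b].
  apply: (is_derive_eq (is_derive_mulf (is_derive_cst (1 : R) x 'e_j) (dF 5 0%N))).
  by rewrite mul0r add0r mul1r.
apply: (is_derive_eq (is_derive_mulf (dF 4^-1 b) (dF 5 b.+1))).
rewrite /link_coef /gate; ring.
Qed.

Lemma derive_chain sg k x (j : 'I_d) : (blk m j < T)%N ->
  'D_('e_j) (chain m T s a sg k) x =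
  a / s * (beta R * (x 0 j / s) +
    2 * (\sum_(b < k) link_coef sg b (blk m j) x) * (x 0 j / s - unit_dir R m sg j)).
Proof.
move=> jT.
have dR := is_derive_sqdist_unit [pred i | (blk m i < T)%N] s (fun=> 0) x j.
have dS := @is_derive_sumf R _ 'I_k (index_enum _) xpredT _ _ x 'e_j
  (fun b _ => is_derive_link sg b x j).
have D := is_derive_scalef a
  (is_derive_addf (is_derive_scalef (beta R / 2) dR) (is_derive_oppf dS)).
rewrite (@derive_val _ _ _ _ _ _ _ D) /= jT sumrN opprK -mulr_suml subr0.
set S := \sum_(b < k) _; field.
by rewrite gt_eqF.
Qed.

(** For a unit vector u, |A e + B u| >= A |e| - B >= B; this is squared and proved by
    Cauchy-Schwarz. *)
Lemma sum_affine_sqr_ge (P : pred 'I_d) (u e : 'I_d -> R) (A B : R) :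
  0 <= B -> 0 <= A -> \sum_(j | P j) u j ^+ 2 = 1 ->
  2 * B <= A * Num.sqrt (\sum_(j | P j) e j ^+ 2) ->
  B ^+ 2 <= \sum_(j | P j) (A * e j + B * u j) ^+ 2.
Proof.
move=> B0 A0 u1; set E := \sum_(j | P j) e j ^+ 2; set n := Num.sqrt E => AB.
have E0 : 0 <= E by apply: sumr_ge0 => j _; exact: sqr_ge0.
set S := \sum_(j | P j) e j * u j.
have -> : \sum_(j | P j) (A * e j + B * u j) ^+ 2 = A ^+ 2 * E + 2 * A * B * S + B ^+ 2.
  have -> : B ^+ 2 = \sum_(j | P j) B ^+ 2 * u j ^+ 2 by rewrite -mulr_sumr u1 mulr1.
  rewrite /E /S !mulr_sumr -!big_split /=.
  by apply: eq_bigr => j _; ring.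
have n0 : 0 <= n by exact: sqrtr_ge0.
have nE : n ^+ 2 = E by rewrite sqr_sqrtr.
have Sn : - n <= S.
  rewrite lerNl; apply: le_trans (ler_norm _) _; rewrite normrN.
  rewrite -(@ler_pXn2r _ 2) ?nnegrE// real_normK ?num_real// nE.
  by apply: le_trans (cauchy_schwarz_sum _ _ _) _; rewrite u1 mulr1.
rewrite lerDr -nE.
have ABS : 2 * A * B * - n <= 2 * A * B * S by rewrite ler_wpM2l// !mulr_ge0.
have : 0 <= A * n * (A * n - 2 * B) by rewrite mulr_ge0 ?subr_ge0// mulr_ge0.
rewrite expr2 expr2; lra.
Qed.

Lemma gate_ge sg b x : block_dist m s sg b x <= 8^-1 -> expR (- 8) <= gate m s sg b x.
Proof.
move=> bd; rewrite /gate /flat.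
have y0 : 8^-1 <= 4^-1 - block_dist m s sg b x by lra.
have y1 : 0 < 4^-1 - block_dist m s sg b x by apply: lt_le_trans y0; rewrite invr_gt0.
rewrite y1 expr0 mul1r ler_expR lerN2 -[leRHS]invrK lef_pV2 ?posrE ?invr_gt0//.
Qed.

Lemma flat2_ge (y : R) : 1 <= y <= 5 -> expR (- 1) / 25 <= flat 2 y.
Proof.
move=> /andP[y1 y5]; have y0 : 0 < y by exact: lt_le_trans y1.
rewrite /flat y0 mulrC ler_pM ?expR_ge0 ?invr_ge0//.
  rewrite exprVn lef_pV2 ?posrE ?exprn_gt0//.
  have -> : 25 = 5 ^+ 2 :> R by ring.
  by rewrite ler_pXn2r ?nnegrE// ltW.
by rewrite ler_expR lerN2 invf_le1.
Qed.

(** Let [c] be the first block at squared distance more than 1/8 from its hidden vector. With e = x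
    / s - u on block [c], the gradient there is a / s times (beta + k) e + beta u, where [k] is the
    pull of the links. *)
Lemma grad_hard_ge sg x : (0 < T)%N ->
  4^-1 < block_dist m s sg T.-1 x -> 4^-1 < spike_dist m T rho sg x ->
  a * beta R / s <= enorm (grad (hard m T s rho a H sg) x).
Proof.
move=> T0 lastD spikeD.
have exb : exists b, (b < T)%N && (8^-1 < block_dist m s sg b x).
  exists T.-1; rewrite ltn_predL T0/=; apply: lt_trans lastD.
  by rewrite ltf_pV2 ?posrE// ltr_nat.
case: (ex_minnP exb) => c /andP[cT cD] cmin.
have gradE j : blk m j = c -> 'D_('e_j) (hard m T s rho a H sg) x =
    a / s * (beta R * (x 0 j / s) +
    2 * (\sum_(b < T) link_coef sg b c x) * (x 0 j / s - unit_dir R m sg j)).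
  move=> jc; rewrite -jc -derive_chain ?jc//; apply: near_eq_derive.
  have := flat_near0 spikeD; apply: filterS => y y0.
  by rewrite /hard /spike y0 mulr0 subr0.
set k := 2 * _ in gradE.
have kge : 2 * link_coef sg c c x <= k.
  rewrite ler_wpM2l// (bigD1 (Ordinal cT))//= lerDl sumr_ge0// => b _.
  exact: link_coef_ge0.
have k0 : 0 <= k by apply: le_trans kge; rewrite mulr_ge0 ?link_coef_ge0.
have b0 : 0 < beta R := beta_gt0 R.
set E := block_dist m s sg c x in cD *.
have E0 : 0 <= E by exact: sqdist_ge0.
have kbeta : E < 4 -> 6 * beta R <= k.
  move=> E4; apply: le_trans kge.
  have f2 : expR (- 1) / 25 <= flat 2 (5 - E) by apply: flat2_ge; lra.
  have e8 : expR (- 8) <= 1 :> R by rewrite expR_le1 oppr_le0.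
  have -> : 6 * beta R = 2 * (expR (- 8) * (expR (- 1) / 25)).
    by rewrite /beta (_ : - 9 = - 8 + - 1); [rewrite expRD; lra|ring].
  rewrite ler_wpM2l//.
  apply: (@le_trans _ _ (expR (- 8) * flat 2 (5 - E))); first by rewrite ler_wpM2l// expR_ge0.
  (* By minimality of [c] the preceding block is within 1/8, so its gate is at least expR (- 8). *)
  rewrite /E; case: (c) cmin cT => [|c'] cmin cT.
    by rewrite /link_coef eqxx mul1r ler_piMl ?flat_ge0.
  rewrite /link_coef eqxx (negbTE (_ : c'.+1 != c')) ?mul0r ?add0r ?mul1r; last first.
    by rewrite neq_ltn ltnSn orbT.
  rewrite ler_wpM2r ?flat_ge0//; apply: gate_ge.
  rewrite leNgt; apply/negP => c'D.
  have /cmin : (c' < T)%N && (8^-1 < block_dist m s sg c' x) by rewrite c'D (ltnW cT).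
  by rewrite ltnn.
have key : beta R ^+ 2 <= \sum_(j | blk m j == c)
    ((beta R + k) * (x 0 j / s - unit_dir R m sg j) + beta R * unit_dir R m sg j) ^+ 2.
  apply: sum_affine_sqr_ge; [exact: ltW|by rewrite addr_ge0// ltW| |].
    exact: (sum_unit_dir_sqr R m0 dimE sg (ltnW cT)).
  (* Nearby, |e| >= 1/3 and k >= 6 beta; far away, |e| >= 2 and the regularizer alone suffices. *)
  have [E4|E4] := ltP E 4.
    have nE : 3^-1 <= Num.sqrt E.
      rewrite -(@ler_pXn2r _ 2) ?nnegrE ?sqrtr_ge0 ?invr_ge0// sqr_sqrtr//.
      by apply: le_trans (ltW cD); rewrite exprVn lef_pV2 ?posrE ?exprn_gt0//; lra.
    apply: (@le_trans _ _ ((6 * beta R) * 3^-1)); first lra.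
    rewrite ler_pM ?invr_ge0 ?mulr_ge0 ?(ltW b0)//.
    by apply: le_trans (kbeta E4) _; rewrite lerDr ltW.
  have nE : 2 <= Num.sqrt E.
    rewrite -(@ler_pXn2r _ 2) ?nnegrE ?sqrtr_ge0// sqr_sqrtr//.
    by apply: le_trans E4; lra.
  rewrite mulrC ler_pM ?(ltW b0)//.
  by rewrite lerDl.
have as0 : 0 <= a / s by rewrite divr_ge0// ltW.
rewrite -(@ler_pXn2r _ 2) ?nnegrE ?sqrtr_ge0//; last by rewrite divr_ge0 ?mulr_ge0// ltW.
rewrite enorm_sqrE (bigID (fun j => blk m j == c))/=.
apply: (@le_trans _ _ ((a / s) ^+ 2 * beta R ^+ 2)); first by rewrite mulrAC exprMn.
apply: le_trans (ler_wpM2l (sqr_ge0 _) key) _.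
rewrite -[leLHS]addr0 lerD//; last by apply: sumr_ge0 => j _; exact: sqr_ge0.
rewrite mulr_sumr le_eqVlt; apply/orP; left; apply/eqP; apply: eq_bigr => j /eqP jc.
by rewrite mxE gradE// [RHS]exprMn; congr (_ * _ ^+ 2); ring.
Qed.

End HardFunctionGradient.

(** * Hiding random signs *)

Section Hiding.
Variable R : realType.

(** This bounds the moment generating function of a random sign. For y >= 1/2, y <= 2 y^2; below,
    expR z <= 1 / (1 - z) gives 2 / (1 - y^2) <= 2 (1 + 2 y^2). *)
Lemma cosh_le (y : R) : expR y + expR (- y) <= 2 * expR (2 * y ^+ 2).
Proof.
wlog y0 : y / 0 <= y.
  move=> wl; have [y0|y0] := leP 0 y; first exact: wl.
  by have := wl (- y); rewrite oppr_ge0 opprK sqrrN addrC; apply; exact: ltW.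
have [y2|y2] := leP 2^-1 y.
  have -> : 2 * expR (2 * y ^+ 2) = expR (2 * y ^+ 2) + expR (2 * y ^+ 2) by ring.
  have yy : y <= 2 * y ^+ 2.
    have : 0 <= y * (2 * y - 1) by rewrite mulr_ge0//; lra.
    by rewrite expr2; lra.
  by apply: lerD; rewrite ler_expR//; lra.
have ub (z : R) : z < 1 -> expR z <= (1 - z)^-1.
  move=> z1; rewrite -[z in leLHS]opprK expRN lef_pV2 ?posrE ?expR_gt0 ?subr_gt0//.
  exact: expR_ge1Dx.
apply: (@le_trans _ _ ((1 - y)^-1 + (1 - - y)^-1)); first by rewrite lerD// ub//; lra.
have q1 : y ^+ 2 <= 4^-1.
  have -> : 4^-1 = 2^-1 ^+ 2 :> R by rewrite exprVn; congr (_^-1); ring.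
  by rewrite ler_pXn2r ?nnegrE// ltW.
apply: (@le_trans _ _ (2 * (1 + 2 * y ^+ 2))); last by rewrite ler_wpM2l// expR_ge1Dx.
have -> : (1 - y)^-1 + (1 - - y)^-1 = 2 / (1 - y ^+ 2).
  field; apply/and3P; split; apply/lt0r_neq0; lra.
rewrite ler_wpM2l//; have q0 := sqr_ge0 y.
rewrite -[leLHS]mul1r ler_pdivrMr; last lra.
have : 0 <= y ^+ 2 * (4^-1 - y ^+ 2) by rewrite mulr_ge0// subr_ge0.
lra.
Qed.

Variable d : nat.
Implicit Types sg : {ffun 'I_d -> bool}.

Definition flip (j : 'I_d) sg : {ffun 'I_d -> bool} :=
  [ffun i => if i == j then ~~ sg i else sg i].

Lemma flipK j : involutive (flip j).
Proof. by move=> sg; apply/ffunP => i; rewrite !ffunE; case: eqP; rewrite ?negbK. Qed.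

(* [w j] may depend on the signs outside r: this is what adaptivity requires. *)
Lemma sum_prod_signs_le (r : seq 'I_d) (w : 'I_d -> {ffun 'I_d -> bool} -> R) :
  uniq r -> (forall i j sg, j \in r -> w i (flip j sg) = w i sg) ->
  \sum_(sg : {ffun 'I_d -> bool})
    \prod_(j <- r) expR ((-1) ^+ sg j * w j sg - 2 * w j sg ^+ 2) <= 2 ^+ d.
Proof.
elim: r => [|j r IH] /= => [_ _|/andP[jr ur] winv].
  under eq_bigr do rewrite big_nil.
  by rewrite sumr_const card_ffun card_bool card_ord natrX.
set G := fun sg => \prod_(i <- r) expR ((-1) ^+ sg i * w i sg - 2 * w i sg ^+ 2).
set g := fun sg => expR ((-1) ^+ sg j * w j sg - 2 * w j sg ^+ 2).
have Gflip sg : G (flip j sg) = G sg.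
  rewrite /G big_seq [RHS]big_seq; apply: eq_bigr => i ir.
  rewrite winv ?mem_head// ffunE ifN//; apply: contraNN jr => /eqP <-//.
under eq_bigr do rewrite big_cons.
rewrite -(@ler_pM2l _ 2)//.
(* Each choice of signs is paired with its flip at [j], which changes neither [G] nor [w j];
   [cosh_le] then bounds each pair. *)
have -> : 2 * \sum_(sg : {ffun 'I_d -> bool}) g sg * G sg =
    \sum_(sg : {ffun 'I_d -> bool}) (g sg + g (flip j sg)) * G sg.
  under [RHS]eq_bigr do rewrite mulrDl.
  rewrite big_split/= mulr_natl mulr2n; congr (_ + _).
  by rewrite (reindex_inj (inv_inj (flipK j))); apply: eq_bigr => sg _; rewrite Gflip.
apply: (@le_trans _ _ (\sum_(sg : {ffun 'I_d -> bool}) 2 * G sg)); last first.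
  rewrite -mulr_sumr ler_wpM2l//; apply: IH => // i k sg kr.
  by rewrite winv// in_cons kr orbT.
apply: ler_sum => sg _; rewrite ler_wpM2r//.
  by apply: prodr_ge0 => i _; exact: expR_ge0.
rewrite /g winv ?mem_head// ffunE eqxx.
have -> : expR ((-1) ^+ sg j * w j sg - 2 * w j sg ^+ 2) +
   expR ((-1) ^+ (~~ sg j) * w j sg - 2 * w j sg ^+ 2) =
   (expR (w j sg) + expR (- w j sg)) * expR (- (2 * w j sg ^+ 2)).
  rewrite [RHS]mulrDl -!expRD.
  by case: (sg j); rewrite /= ?expr0 ?expr1 ?mulN1r ?mul1r// addrC.
by rewrite [X in _ * X <= _]expRN ler_pdivrMr ?expR_gt0//; exact: cosh_le.
Qed.

Variables m T : nat.
Hypotheses (m0 : (0 < m)%N) (dimE : (T.+1 * m <= d)%N).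

(* For z the block of y / rho, |z - u|^2 <= 1/4 means
   2 <u, z> - |z|^2 - 3/4 >= 0. Multiplying by m / 8 before exponentiating makes
   the Gaussian bound for the signs cancel |z|^2, so no bound on y is needed. *)
Lemma card_hit_le (b : nat) (rho : R) (y : {ffun 'I_d -> bool} -> 'rV[R]_d) :
  0 < rho -> (b <= T)%N ->
  (forall j sg, blk m j = b -> y (flip j sg) = y sg) ->
  (#|[pred sg : {ffun 'I_d -> bool} | block_dist m rho sg b (y sg) <= 4^-1]|%:R : R) <=
    expR (- (3 / 32 * m%:R)) * 2 ^+ d.
Proof.
move=> rho0 bT yinv.
set M := Num.sqrt m%:R : R.
have M0 : 0 < M by rewrite sqrtr_gt0 ltr0n.
have MM : M ^+ 2 = m%:R by rewrite sqr_sqrtr ?ler0n.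
(* With these weights the exponent is m / 8 (1 - |z - u|^2), at least 3 m / 32 on a hit. *)
pose w (j : 'I_d) sg : R := if blk m j == b then M * (y sg 0 j / rho) / 4 else 0.
pose r := [seq j <- enum 'I_d | blk m j == b].
have winv i j sg : j \in r -> w i (flip j sg) = w i sg.
  by rewrite mem_filter => /andP[/eqP jb _]; rewrite /w yinv.
have ur : uniq r by rewrite filter_uniq// enum_uniq.
have := sum_prod_signs_le ur winv.
rewrite -(@ler_pM2l _ (expR (- (3 / 32 * m%:R)))) ?expR_gt0//; apply: le_trans.
rewrite mulr_sumr -sum1_card natr_sum big_mkcond/=; apply: ler_sum => sg _.
rewrite inE; case: ifP => [|_]; last first.
  by rewrite mulr_ge0 ?expR_ge0// prodr_ge0// => j _; exact: expR_ge0.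
move=> hit; rewrite -expR_sum -expRD -[leLHS]expR0 ler_expR.
rewrite big_filter big_enum_cond/=.
have -> : \sum_(j | blk m j == b) ((-1) ^+ sg j * w j sg - 2 * w j sg ^+ 2) =
    m%:R / 8 * (1 - block_dist m rho sg b (y sg)).
  have u1 := sum_unit_dir_sqr R m0 dimE sg bT.
  rewrite -[X in X - block_dist _ _ _ _ _]u1 /block_dist -sumrB mulr_sumr.
  apply: eq_bigr => j jb; rewrite /w jb /unit_dir -/M -MM.
  by field; rewrite !gt_eqF.
have : 3 / 4 <= 1 - block_dist m rho sg b (y sg) by lra.
have mR : 0 <= m%:R :> R by exact: ler0n.
move=> h; have := ler_wpM2l mR h.
lra.
Qed.

End Hiding.

(** * Measurability of trajectories *)

Section MeasurableTrajectories.
Variables (R : realType) (d : nat).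

Lemma measurable_coordinate (disp : measure_display) (T : measurableType disp)
    (I : Type) (X : pointedType) (pr : I -> X -> T) (i : I) :
  measurable_fun setT (pr i : g_sigma_algebraType (coordinate_sets pr) -> T).
Proof.
move=> _ B mB; rewrite setTI; apply: sub_sigma_algebra.
by exists i => //; exists B.
Qed.

(** An open set is a countable union of boxes with rational centers and radii 1 / (n + 1). *)
Lemma open_measurable_point (U : set 'rV[R]_d) : open U ->
  measurable (U : set (Defs.point R d)).
Proof.
move=> oU.
pose box (qn : {ffun 'I_d -> rat} * nat) : set (Defs.point R d) :=
  [set x : 'rV[R]_d | forall j, `|x 0 j - ratr (qn.1 j)| < qn.2.+1%:R^-1].
have -> : U = \bigcup_(qn in [set qn | box qn `<=` U]) box qn.
  apply/seteqP; split=> [x Ux|x [qn /= sub /sub//]].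
  have /nbhs_ballP[e /= e0 eU] : nbhs x U by exact: open_nbhs_nbhs.
  have e20 : 0 < e / 2 by rewrite divr_gt0.
  have [n nE] : exists n, n.+1%:R^-1 < e / 2.
    have /= := near_infty_natSinv_lt (PosNum e20).
    by case=> n _ /(_ n) /= h; exists n; exact: h.
  have qex j : {q : rat | `|x 0 j - ratr q| < n.+1%:R^-1}.
    have := @rat_in_itvoo R (x 0 j - n.+1%:R^-1) (x 0 j + n.+1%:R^-1).
    have n0 : 0 < n.+1%:R^-1 :> R by rewrite invr_gt0.
    have lt1 : x 0 j - n.+1%:R^-1 < x 0 j + n.+1%:R^-1 by rewrite ltrBlDr -addrA ltrDl addr_gt0.
    move=> /(_ lt1)/cid[q]; rewrite in_itv/= => qx; exists q.
    by rewrite ltr_distlC.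
  exists ([ffun j => sval (qex j)], n) => /=; last first.
    by move=> j; rewrite ffunE; exact: (svalP (qex j)).
  move=> y yb; apply: eU; split=> // i j; rewrite ord1 /ball /=.
  have := yb j; rewrite ffunE /= => yj; have := svalP (qex j) => /= xj.
  rewrite -[_ - _](subrKA (ratr (sval (qex j)))).
  apply: (le_lt_trans (ler_normD _ _)); rewrite (distrC _ (y 0 j)) (splitr e).
  by rewrite ltrD// (lt_trans _ nE).
rewrite bigcup_mkcond; apply: countable_bigcupT_measurable => [|qn]; first exact: countableP.
case: ifP => // _.
rewrite (_ : box qn = \bigcap_(j in [set: 'I_d])
   ((fun x : Defs.point R d => (x : 'rV[R]_d) 0 j) @^-1`
      [set r : measurableTypeR R | `|r - ratr (qn.1 j)| < qn.2.+1%:R^-1])); last first.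
  by apply/seteqP; split=> x /= h j; [move=> _; exact: h|exact: h].
apply: fin_bigcap_measurable => // j _; rewrite -[X in measurable X]setTI.
apply: (@measurable_coordinate _ (measurableTypeR R) 'I_d 'rV[R]_d
  (fun j x => x 0 j) j measurableT).
rewrite (_ : [set r | _] = `]ratr (qn.1 j) - qn.2.+1%:R^-1, ratr (qn.1 j) + qn.2.+1%:R^-1[%classic).
  exact: measurable_itv.
by apply/seteqP; split => r; rewrite /= in_itv/= ltr_distl.
Qed.

Lemma continuous_measurable_point (g : 'rV[R]_d -> R) : continuous g ->
  measurable_fun setT (g : Defs.point R d -> measurableTypeR R).
Proof.
move=> cg; apply: (@measurability _ _ (Defs.point R d) (measurableTypeR R) setT g _
  (RGenOpens.measurableE R)) => _ [_ [a [b ->]] <-].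
rewrite setTI; apply: open_measurable_point.
by apply: open_comp => // x _; exact: cg.
Qed.

Lemma continuous_partials (f : 'rV[R]_d -> R) s : Cinfty f -> continuous (partials s f).
Proof.
move=> Cf; suff : Cinfty (partials s f) by move/(_ 0%N).
by elim: s => [//|j s IH] k /=; case: (IH k.+1) => _; exact.
Qed.

Lemma measurable_jets_at (f : 'rV[R]_d -> R) : Cinfty f ->
  measurable_fun setT (jets_at f : Defs.point R d -> jets R d).
Proof.
move=> Cf; pose G := @coordinate_sets _ (measurableTypeR R) _ _
  (fun (s : seq 'I_d) (h : seq 'I_d -> R) => h s).
apply: (@measurability _ _ (Defs.point R d) (jets R d) setT (jets_at f) G) => //.
move=> _ [_ [s _ [B mB <-]] <-].
exact: (continuous_measurable_point (continuous_partials (s := s) Cf) measurableT mB).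
Qed.

Lemma continuous_enorm_grad (f : 'rV[R]_d -> R) : Cinfty f ->
  continuous (fun x => enorm (grad f x)).
Proof.
move=> Cf; have cS : continuous (fun x => \sum_j grad f x 0 j ^+ 2).
  apply: (Ck_sum (k := 0)) => j _ y; have Cj := continuous_partials (s := [:: j]) Cf.
  rewrite (_ : (fun x => _) = (fun x => 'D_('e_j) f x * 'D_('e_j) f x)).
    exact: (continuousM (Cj y) (Cj y)).
  by apply/funext => z; rewrite mxE expr2.
move=> x; apply: (@continuous_comp _ _ _ (fun x => \sum_j grad f x 0 j ^+ 2)).
  exact: cS.
exact: sqrt_continuous.
Qed.

Lemma measurable_rcons (disp disp' : measure_display) (T1 : measurableType disp)
    (T2 : measurableType disp') n (g : T1 -> n.-tuple T2) (h : T1 -> T2) :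
  measurable_fun setT g -> measurable_fun setT h ->
  measurable_fun setT (fun x => [tuple of rcons (g x) (h x)]).
Proof.
move=> mg mh; apply/measurable_fun_tnthP => i.
have [ni|ni] := ltnP i n.
  rewrite (_ : _ \o _ = fun x => tnth (g x) (Ordinal ni)); last first.
    apply/funext => x /=; rewrite (tnth_nth (h x)) (tnth_nth (h x)) /=.
    by rewrite nth_rcons size_tuple ni.
  by move/measurable_fun_tnthP : mg; exact.
rewrite (_ : _ \o _ = h)//; apply/funext => x /=.
have iN : i = n :> nat by apply/eqP; rewrite eqn_leq ni -ltnS ltn_ord.
by rewrite (tnth_nth (h x)) /= nth_rcons size_tuple iN ltnn eqxx.
Qed.

Variable A : algorithm R.
Hypothesis mA : forall i, measurable_fun setT (@A d i).

Lemma measurable_history (f : 'rV[R]_d -> R) i : Cinfty f ->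
  measurable_fun setT (fun xi : measurableTypeR R => history A f xi i).
Proof.
move=> Cf; elim: i => [|i IH] /=; first exact: measurable_cst.
apply: measurable_rcons => //.
have m1 := measurable_fun_pair (@measurable_id _ (measurableTypeR R) setT) IH.
exact: (measurableT_comp (measurable_jets_at Cf) (measurableT_comp (@mA i) m1)).
Qed.

Lemma measurable_iterates (f : 'rV[R]_d -> R) i : Cinfty f ->
  measurable_fun setT (fun xi : measurableTypeR R => iterates A f xi i).
Proof.
move=> Cf; have m1 := measurable_fun_pair
  (@measurable_id _ (measurableTypeR R) setT) (measurable_history (i := i) Cf).
exact: (measurableT_comp (@mA i) m1).
Qed.

Lemma measurable_grad_gt (f : 'rV[R]_d -> R) (eps : R) (t : nat) : Cinfty f ->
  measurable [set xi : measurableTypeR R |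
    forall i, (i < t)%N -> eps < enorm (grad f (iterates A f xi i))].
Proof.
move=> Cf.
rewrite (_ : [set xi | _] = \bigcap_(i in `I_t)
    ((fun xi : measurableTypeR R => (enorm (grad f (iterates A f xi i)) : measurableTypeR R))
       @^-1` `]eps, +oo[)).
  apply: fin_bigcap_measurable => // i _; rewrite -[X in measurable X]setTI.
  have m1 := continuous_measurable_point (continuous_enorm_grad Cf).
  have := measurableT_comp m1 (@measurable_iterates f i Cf).
  by apply => //; exact: measurable_itv.
by apply/seteqP; split=> xi /= h i it; have := h i it; rewrite ?in_itv /= ?in_itv/= ?andbT.
Qed.

End MeasurableTrajectories.

(** * Resisting an algorithm *)

(** Otherwise integrating the count of events would give c <= sum of the [P (G i)] <= |I| b < c. *)
Lemma exists_likely_event (disp : measure_display) (R : realType)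
    (W : measurableType disp) (P : probability W R) (I : finType)
    (G : I -> set W) (b c : R) :
  (forall i, measurable (G i)) -> 0 <= c -> #|I|%:R * b < c ->
  (forall w, c <= \sum_i \1_(G i) w) -> exists i, (b%:E < P (G i))%E.
Proof.
move=> mG c0 bc count; apply: contrapT => none.
have PG i : (P (G i) <= b%:E)%E by rewrite leNgt; apply/negP => h; apply: none; exists i.
have : (c%:E <= \sum_i P (G i))%E.
  have -> : (\sum_i P (G i) = \int[P]_w (\sum_i (\1_(G i) w)%:E))%E.
    rewrite ge0_integral_sum//.
      by apply: eq_bigr => i _; rewrite integral_indic// setIT.
    by move=> i; apply/measurable_EFinP; exact: measurable_indic.
  have -> : (c%:E = \int[P]_w c%:E)%E by rewrite integral_cst//= probability_setT mule1.
  apply: ge0_le_integral => //.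
  - by apply: emeasurable_sum => i; apply/measurable_EFinP; exact: measurable_indic.
  - by move=> w _; rewrite sumEFin lee_fin.
have : (\sum_i P (G i) <= (#|I|%:R * b)%:E)%E.
  apply: (@le_trans _ _ (\sum_(i : I) b%:E)%E); first exact: lee_sum.
  by rewrite sumEFin lee_fin sumr_const mulr_natl.
by move=> /[swap] /le_trans/[apply]; rewrite lee_fin leNgt bc.
Qed.

Section Resisting.
Variables (R : realType) (d m T : nat) (s rho a H eps : R).
Hypotheses (m0 : (0 < m)%N) (dimE : (T.+1 * m <= d)%N).
Hypotheses (s0 : 0 < s) (rho0 : 0 < rho) (a0 : 0 <= a).
Implicit Types (sg : {ffun 'I_d -> bool}) (x : 'rV[R]_d) (A : algorithm R) (xi : R).

Local Notation objective_of sg := (hard m T s rho a H sg).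

(* The trajectory obtained when query i is answered with the jets of
   chain (i+1), which involves the signs of the blocks 0, .., i only. *)
Fixpoint hybrid A sg xi i : i.-tuple (jets R d) :=
  if i is i'.+1 then
    let h := hybrid A sg xi i' in
    [tuple of rcons h (jets_at (chain m T s a sg i'.+1) (A d i' (xi, h)))]
  else [tuple].

Definition query A sg xi i : 'rV[R]_d := A d i (xi, hybrid A sg xi i).

Lemma hybrid_eq_signs A sg sg' xi i : (forall j, (blk m j < i)%N -> sg j = sg' j) ->
  hybrid A sg xi i = hybrid A sg' xi i.
Proof.
elim: i => [//|i IH] e /=.
by rewrite (chain_eq_signs T s a e) IH// => j ji; apply: e; exact: ltnW.
Qed.

(** Query [i] depends on the blocks below [i] only, so a hit on a block b >= i is a blind guess.
    Block [T] is measured at the scale [rho] of the spike. *)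
Definition lucky A xi sg : bool :=
  [exists i : 'I_T, exists b : 'I_T.+1, (i <= b)%N &&
    (block_dist m (if b == T :> nat then rho else s) sg b (query A sg xi i) <= 4^-1)].

Lemma card_lucky_le A xi :
  (#|[pred sg | lucky A xi sg]|%:R : R) <=
    T%:R * T.+1%:R * expR (- (3 / 32 * m%:R)) * 2 ^+ d.
Proof.
pose hit (i : 'I_T) (b : 'I_T.+1) := [pred sg : {ffun 'I_d -> bool} | (i <= b)%N &&
    (block_dist m (if b == T :> nat then rho else s) sg b (query A sg xi i) <= 4^-1)].
have hit_le i b : (#|hit i b|%:R : R) <= expR (- (3 / 32 * m%:R)) * 2 ^+ d.
  have [ib|bi] := leqP i b; last first.
    rewrite (_ : #|hit i b| = 0%N) ?mulr_ge0 ?expR_ge0 ?exprn_ge0//.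
    by apply: eq_card0 => sg; rewrite !inE leqNgt bi.
  have r0 : 0 < (if b == T :> nat then rho else s) by case: ifP.
  have bT : (b <= T)%N by rewrite -ltnS.
  apply: le_trans (card_hit_le m0 dimE r0 bT (y := fun sg => query A sg xi i) _).
    by rewrite ler_nat; apply: subset_leq_card;
      apply/fintype.subsetP => sg; rewrite !inE => /andP[].
  (* Flipping a sign of block b >= i leaves query [i] unchanged, as [card_hit_le] requires. *)
  move=> j sg jb; rewrite /query (@hybrid_eq_signs _ (flip j sg) sg)// => k ki.
  by rewrite ffunE ifN//; apply: contraTneq ki => ->; rewrite jb -leqNgt.
have : (#|[pred sg | lucky A xi sg]| <= \sum_i \sum_b #|hit i b|)%N.
  rewrite -sum1_card big_mkcond/=.
  under [leqRHS]eq_bigr do under eq_bigr do rewrite -sum1_card big_mkcond.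
  under [leqRHS]eq_bigr do rewrite exchange_big.
  rewrite exchange_big/=; apply: leq_sum => sg _.
  rewrite inE; case: ifP => // /existsP[i /existsP[b h]].
  by rewrite (bigD1 i)//= (bigD1 b)//= inE h.
rewrite -(ler_nat R) => /le_trans; apply; rewrite natr_sum.
apply: (@le_trans _ _ (\sum_(i < T) \sum_(b < T.+1) (expR (- (3 / 32 * m%:R)) * 2 ^+ d))).
  by apply: ler_sum => i _; rewrite natr_sum; exact: ler_sum.
by rewrite !sumr_const !card_ord -mulrnA -[leLHS]mulr_natl natrM mulrA (mulrC T.+1%:R).
Qed.

Lemma block_dist_spike_le sg x : block_dist m rho sg T x <= spike_dist m T rho sg x.
Proof.
rewrite /block_dist /spike_dist /sqdist big_mkcond; apply: ler_sum => j _.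
by rewrite /= /spike_center; case: (blk m j == T) => //; exact: sqr_ge0.
Qed.

Lemma unlucky_dist A xi sg i : ~~ lucky A xi sg -> (i < T)%N ->
  (forall b, (i <= b < T)%N -> 4^-1 < block_dist m s sg b (query A sg xi i)) /\
  4^-1 < spike_dist m T rho sg (query A sg xi i).
Proof.
move=> /existsPn unl iT; have {unl} /existsPn unl := unl (Ordinal iT).
split=> [b /andP[ib bT]|].
  have := unl (Ordinal (ltnW bT : b < T.+1)%N).
  by rewrite /= ib ltn_eqF// -ltNge.
apply: lt_le_trans (block_dist_spike_le _ _).
by have := unl ord_max; rewrite /= (ltnW iT) eqxx -ltNge.
Qed.

(** By induction the queries agree; near an unlucky query the hard function is the truncated chain,
    so the answers agree too. *)
Lemma unlucky_history A xi sg n : ~~ lucky A xi sg -> (n <= T)%N ->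
  history A (objective_of sg) xi n = hybrid A sg xi n.
Proof.
move=> unl; elim: n => [//|n IH] nT /=; rewrite IH ?(ltnW nT)//.
congr [tuple of rcons _ _]; apply/funext => q; apply: partials_near_eq.
have [far spike_far] := unlucky_dist unl nT.
exact: hard_near_chain.
Qed.

Lemma unlucky_grad A xi sg i : eps < a * beta R / s -> ~~ lucky A xi sg -> (i < T)%N ->
  eps < enorm (grad (objective_of sg) (iterates A (objective_of sg) xi i)).
Proof.
move=> epsE unl iT; apply: (lt_le_trans epsE).
rewrite /iterates (unlucky_history unl (ltnW iT)) -/(query A sg xi i).
have T0 : (0 < T)%N by exact: leq_ltn_trans iT.
have [far spike_far] := unlucky_dist unl iT.
(* The last block T - 1 is still hidden, since T - 1 >= i. *)
apply: (grad_hard_ge H m0 dimE s0 a0) => //; apply: far.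
by rewrite ltn_predL T0 andbT -ltnS prednK.
Qed.

(* An algorithm is measurable only for seeds in [0, 1]; clamping the seed
   gives a measurable function of all reals without changing the law. *)
Definition clamp xi : R := Num.max 0 (Num.min xi 1).

Lemma clamp_id xi : xi \in `[0, 1]%R -> clamp xi = xi.
Proof.
rewrite in_itv/= => /andP[x0 x1]; rewrite /clamp.
by rewrite (min_idPl x1) (max_idPr x0).
Qed.

Lemma clamp_itv xi : clamp xi \in `[0, 1]%R.
Proof. by rewrite in_itv/= le_max lexx/= ge_max ler01 ge_min lexx orbT. Qed.

Lemma measurable_clamp : measurable_fun setT (clamp : measurableTypeR R -> measurableTypeR R).
Proof.
by apply: measurable_maxr; [exact: measurable_cst|
  apply: measurable_minr; [exact: measurable_id|exact: measurable_cst]].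
Qed.

Definition clamped A : algorithm R := fun d' i p => A d' i (clamp p.1, p.2).

Lemma iterates_clamped A (f : 'rV[R]_d -> R) xi i :
  iterates (clamped A) f xi i = iterates A f (clamp xi) i.
Proof.
rewrite /iterates /clamped/=; congr (A d i (_, _)).
by elim: i => [//|i IH] /=; rewrite IH.
Qed.

Lemma measurable_clamped A i : @Arand R A -> measurable_fun setT (@clamped A d i).
Proof.
move=> mA; have mp : measurable_fun setT
    (fun p : measurableTypeR R * i.-tuple (jets R d) => (clamp p.1, p.2)).
  apply: measurable_fun_pair; last exact: measurable_snd.
  exact: (measurableT_comp measurable_clamp measurable_fst).
apply: (measurable_comp _ _ (mA d i) mp).
  by apply: measurableX => //; exact: measurable_itv.
by move=> _ [p _ <-]; split => //=; exact: clamp_itv.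
Qed.

(** The uniform law charges only [0, 1], where [clamp] is the identity. *)
Lemma law_clamped A (f : 'rV[R]_d -> R) (S : set (trajectory R d)) :
  law A f S = uniform_prob (@ltr01 R) (iterates (clamped A) f @^-1` S).
Proof.
rewrite /law /pushforward /uniform_prob integral_uniform_pdf [RHS]integral_uniform_pdf.
congr (integral _ _ _); apply/seteqP; split=> xi /= [hS xi01]; split=> //.
- rewrite (_ : iterates _ _ _ = iterates A f xi)//; apply/funext => i.
  by rewrite iterates_clamped clamp_id.
- rewrite (_ : iterates _ _ _ = iterates (clamped A) f xi)//; apply/funext => i.
  by rewrite iterates_clamped clamp_id.
Qed.

(** For every seed at most a quarter of the signs are lucky; averaging over the seed gives signs
    that fail with probability above 1/2. *)
Lemma exists_resisting_signs A : @Arand R A -> eps < a * beta R / s ->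
  T%:R * T.+1%:R * expR (- (3 / 32 * m%:R)) <= 4^-1 :> R ->
  exists sg, ((2^-1)%:E < law A (objective_of sg)
    [set x | forall i, (i < T)%N -> (eps < enorm (grad (objective_of sg) (x i)))%R])%E.
Proof.
move=> mA epsE small.
pose G sg := [set xi : measurableTypeR R | forall i, (i < T)%N ->
  eps < enorm (grad (objective_of sg) (iterates (clamped A) (objective_of sg) xi i))].
have mG sg : measurable (G sg).
  apply: measurable_grad_gt; first by move=> i; exact: measurable_clamped.
  exact: Cinfty_hard.
have count xi : 3 / 4 * 2 ^+ d <= \sum_(sg : {ffun 'I_d -> bool}) \1_(G sg) xi :> R.
  have := card_lucky_le (clamped A) xi.
  have : 2 ^+ d <= #|[pred sg | lucky (clamped A) xi sg]|%:R +
      \sum_(sg : {ffun 'I_d -> bool}) \1_(G sg) xi :> R.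
    have -> : 2 ^+ d = \sum_(sg : {ffun 'I_d -> bool}) 1 :> R.
      by rewrite sumr_const card_ffun card_bool card_ord natrX.
    rewrite -sum1_card natr_sum [X in _ <= X + _]big_mkcond -big_split; apply: ler_sum => sg _ /=.
    rewrite inE; have [luck|unl] := boolP (lucky (clamped A) xi sg).
      by rewrite lerDl indicE.
    by rewrite add0r indicE mem_set// => i iT; exact: unlucky_grad.
  have := ler_wpM2r (exprn_ge0 d (ler0n R 2)) small.
  lra.
have d20 : 0 < 2 ^+ d :> R by rewrite exprn_gt0.
have [||sg PG] := @exists_likely_event _ _ _ (uniform_prob (@ltr01 R)) _ G 2^-1 _ mG _ _ count.
- by rewrite mulr_ge0// ltW.
- by rewrite card_ffun card_bool card_ord natrX mulrC ltr_pM2r//; lra.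
by exists sg; rewrite law_clamped.
Qed.

End Resisting.

(** * From resisting signs to the complexity *)

Section ComplexityBound.
Variables (R : realType) (d m T : nat) (s rho a H eps : R).
Hypotheses (m0 : (0 < m)%N) (dimE : (T.+1 * m <= d)%N).
Hypotheses (s0 : 0 < s) (rho0 : 0 < rho) (a0 : 0 <= a) (H0 : 0 <= H).
Implicit Types (sg : {ffun 'I_d -> bool}).

Lemma hard_in_Fdist (p : nat) (D L : R) sg : (1 <= p)%N -> 2 * rho <= D ->
  a * T%:R < H * expR (- 4) ->
  a * smoothness_const R p.+1 / s ^+ p.+1 + H * smoothness_const R p.+1 / rho ^+ p.+1 <= L ->
  Fdist p D L (existT (fun d => 'rV[R]_d -> R) d (hard m T s rho a H sg)).
Proof.
move=> p1 rD aH KL; have [ne amin] := argmin_hard s m0 dimE rho0 a0 sg aH.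
split=> //=.
- by apply: leq_trans dimE; rewrite muln_gt0.
- exact: Cinfty_hard.
- split; first exact: Cinfty_hard.
  move=> x v v1; apply: derive_bounded_lipschitz; apply: (derive_bounded_le KL).
  exact: derive_bounded_hard.
- apply: ge_ereal_sup => _ [x /amin xr <-].
  by rewrite lee_fin (le_trans xr).
Qed.

(** Any class containing the hard functions is allowed, which covers the restriction to one
    dimension. *)
Lemma complexity_ge (FF : set (objective R)) :
  (forall sg, FF (existT (fun d => 'rV[R]_d -> R) d (hard m T s rho a H sg))) ->
  eps < a * beta R / s ->
  T%:R * T.+1%:R * expR (- (3 / 32 * m%:R)) <= 4^-1 :> R ->
  (T.+1%:R%:E <= complexity eps (@Arand R) FF)%E.
Proof.
move=> hardFF epsE small; apply: le_ereal_inf_tmp => _ [A mA <-].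
have [sg lawT] := exists_resisting_signs H m0 dimE s0 rho0 a0 mA epsE small.
set f := hard m T s rho a H sg in lawT.
apply: (@le_trans _ _ (Teps eps (law A f) f)); last first.
  by apply: ereal_sup_ubound; exists (existT (fun d => 'rV[R]_d -> R) d f); [exact: hardFF|].
apply: le_ereal_inf_tmp => _ [t [t1 lawt] <-].
rewrite lee_fin ler_nat ltnNge; apply/negP => tT.
move: lawt; rewrite leNgt => /negP; apply; apply: (lt_le_trans lawT).
(* Failure during [T] steps implies failure during any t <= T; monotonicity of the measure needs
   both events measurable. *)
have mG n : measurable [set xi : measurableTypeR R | forall i, (i < n)%N ->
    eps < enorm (grad f (iterates (clamped A) f xi i))].
  apply: measurable_grad_gt; first by move=> i; exact: measurable_clamped.
  exact: Cinfty_hard.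
rewrite !law_clamped; apply: (le_measure (uniform_prob (@ltr01 R)));
  rewrite ?inE; [exact: mG|exact: mG|].
by move=> xi /= h i it; apply: h; exact: leq_trans tT.
Qed.

End ComplexityBound.

(** * Choice of the parameters *)

Section Constants.
Variable R : realType.

Lemma ln_ge (x : R) : 0 < x -> 1 - x^-1 <= ln x.
Proof.
move=> x0; have xV : 0 < x^-1 by rewrite invr_gt0.
have h : -1 < x^-1 - 1 by lra.
have := le_ln1Dx h.
by rewrite addrCA subrr addr0 lnV ?posrE//; lra.
Qed.

Definition ell (p : nat) : R := expR (100 * p%:R * ln p%:R + 100).

Lemma smoothness_const_le (p : nat) : (1 <= p)%N ->
  smoothness_const R p.+1 <= (4 * p%:R) ^+ (15 * p).
Proof.
move=> p1; set y : R := 4 * p%:R.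
have pR : 1 <= p%:R :> R by rewrite ler1n.
have y4 : 4 <= y by rewrite /y; lra.
have y1 : 1 <= y by lra.
have y0 : 0 <= y by lra.
have NE : (2 * p.+1)%:R = 2 * (p%:R + 1) :> R by rewrite natrM -[p.+1]addn1 natrD.
have Ny : (2 * p.+1)%:R <= y by rewrite NE /y; lra.
have N0 : 0 <= (2 * p.+1)%:R :> R by exact: ler0n.
have By : 10 + 12 * (2 * p.+1)%:R <= y ^+ 3.
  have N4 : 4 <= (2 * p.+1)%:R :> R by rewrite NE; lra.
  have -> : y ^+ 3 = y ^+ 2 * y by ring.
  have y16 : 15 <= y ^+ 2 by rewrite expr2; nra.
  apply: (@le_trans _ _ (15 * y)); first lra.
  by rewrite ler_wpM2r.
set z := y ^+ (2 * p.+1) ^+ 2 * (y ^+ 3) ^+ p.+1.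
have z1 : 1 <= z by rewrite mulr_ege1 ?exprn_ege1.
apply: (@le_trans _ _ (1 + 2 * z)).
  have B0 : 0 <= 10 + 12 * (2 * p.+1)%:R :> R by lra.
  rewrite lerD2l -mulrA ler_wpM2l//; apply: ler_pM; rewrite ?exprn_ge0//.
    by rewrite !lerXn2r ?nnegrE ?exprn_ge0.
  by rewrite lerXn2r ?nnegrE ?exprn_ge0.
apply: (@le_trans _ _ (y * z)).
  apply: (@le_trans _ _ (4 * z)); first lra.
  by rewrite ler_wpM2r// (le_trans ler01).
(* The exponents add up to 7 p + 8 <= 15 p. *)
rewrite /z -!exprM -exprD -exprS ler_weXn2l//; lia.
Qed.

(** All factors but expR 13 are absorbed into powers of y = 4 p, with total exponent 24 p. *)
Lemma ell_ge (p : nat) : (1 <= p)%N ->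
  smoothness_const R p.+1 * 2 ^+ (p + 4) * expR 4 / beta R <= ell p.
Proof.
move=> p1; set y : R := 4 * p%:R.
have pR : 1 <= p%:R :> R by rewrite ler1n.
have p0 : 0 < p%:R :> R by lra.
have y4 : 4 <= y by rewrite /y; lra.
have y1 : 1 <= y by lra.
have y0 : 0 < y by lra.
have K0 : 0 <= smoothness_const R p.+1.
  by rewrite addr_ge0// !mulr_ge0 ?exprn_ge0// addr_ge0// mulr_ge0.
have -> : smoothness_const R p.+1 * 2 ^+ (p + 4) * expR 4 / beta R =
    75 * 2 ^+ (p + 4) * smoothness_const R p.+1 * expR 13.
  rewrite /beta invf_div -expRN opprK (_ : 13 = 9 + 4) ?expRD; [ring|ring].
have h75 : 75 <= y ^+ (4 * p).
  apply: (@le_trans _ _ (y ^+ 4)); last by rewrite ler_weXn2l// leq_pmulr.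
  apply: (@le_trans _ _ (4 ^+ 4)); first by rewrite -natrX ler_nat.
  by rewrite lerXn2r ?nnegrE ?(ltW y0).
have h2 : 2 ^+ (p + 4) <= y ^+ (5 * p).
  apply: (@le_trans _ _ (y ^+ (p + 4))); first by rewrite lerXn2r ?nnegrE ?(ltW y0)//; lra.
  rewrite ler_weXn2l//; lia.
have hK := smoothness_const_le p1; rewrite -/y in hK.
apply: (@le_trans _ _ (y ^+ (24 * p) * expR 13)).
  rewrite ler_wpM2r ?expR_ge0//.
  have -> : y ^+ (24 * p) = y ^+ (4 * p) * y ^+ (5 * p) * y ^+ (15 * p).
    by rewrite -!exprD -!mulnDl.
  by rewrite !ler_pM ?mulr_ge0 ?exprn_ge0.
have -> : y ^+ (24 * p) = expR ((24 * p)%:R * ln y) by rewrite expRM_natl lnK ?posrE.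
rewrite -expRD ler_expR natrM.
have ln4 : ln 4 <= 3 :> R.
  have h : -1 < 3 :> R by lra.
  have := le_ln1Dx h; rewrite (_ : 1 + 3 = 4)//; ring.
have lny : ln y <= 3 + ln p%:R by rewrite lnM ?posrE// lerD2r.
(* This absorbs the linear term 72 p, so that the exponent is at most 96 p ln p + 85. *)
have plnp : p%:R - 1 <= p%:R * ln p%:R :> R.
  have := ler_wpM2l (ltW p0) (ln_ge p0).
  by rewrite mulrBr mulr1 divff ?gt_eqF.
have : 24 * p%:R * ln y <= 24 * p%:R * (3 + ln p%:R) by rewrite ler_wpM2l// mulr_ge0.
lra.
Qed.

Lemma exists_block_size (X : R) (d : nat) : 0 <= X ->
  Num.max 1 (1 + 68 * (X ^+ 2 * ln (2 * X))) <= d%:R ->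
  exists m, [/\ (0 < m)%N, ((Num.truncn X).+1 * m <= d)%N &
    (Num.truncn X)%:R * (Num.truncn X).+1%:R * expR (- (3 / 32 * m%:R)) <= 4^-1 :> R].
Proof.
move=> X0; set T := Num.truncn X; rewrite ge_max => /andP[d1 dX].
have TX : T%:R <= X by rewrite truncn_le.
case T0 : (T == 0%N).
  move/eqP: T0 => T0; exists 1%N; split=> //; last by rewrite T0 !mul0r invr_ge0.
  by rewrite T0 mul1n -(ler_nat R).
have T1 : 1 <= T%:R :> R by rewrite ler1n lt0n T0.
have X1 : 1 <= X by lra.
have TS : T.+1%:R <= 2 * X by rewrite -[T.+1]addn1 natrD; lra.
set l := ln (2 * X) in dX *.
have X20 : 0 < 2 * X by lra.
have l2 : 2^-1 <= l.
  apply: le_trans (ln_ge X20); have : (2 * X)^-1 <= 2^-1 by rewrite lef_pV2 ?posrE//; lra.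
  lra.
(* Since T + 1 <= 2 X, blocks of size at most [u] need at most 68 X^2 l coordinates. *)
set u := 34 * X * l.
have u0 : 0 <= u by rewrite !mulr_ge0//; lra.
have ul : 34 * l <= u by rewrite /u ler_wpM2r//; lra.
exists (Num.truncn u); set m := Num.truncn u.
have mu_le : m%:R <= u by rewrite truncn_le.
have mu_gt : u < m%:R + 1 by rewrite natr1; exact: truncnS_gt.
split.
- by rewrite -(ltr_nat R); lra.
- rewrite -(ler_nat R) natrM.
  apply: (@le_trans _ _ (2 * X * u)); first by rewrite ler_pM ?ler0n.
  rewrite /u; lra.
(* As l >= 1/2, m >= 34 l - 1 >= 32 l, so the exponential is at most (2 X)^-3. *)
- apply: (@le_trans _ _ (2 * X ^+ 2 * expR (- (3 * l)))).
    rewrite ler_pM ?mulr_ge0 ?expR_ge0 ?ler0n//; last by rewrite ler_expR; lra.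
    by rewrite expr2 mulrCA ler_pM ?ler0n.
  rewrite expRN expRM_natl lnK ?posrE// ler_pdivrMr ?exprn_gt0//.
  have X23 : X ^+ 2 <= X ^+ 3 by rewrite ler_weXn2l.
  have -> : 4^-1 * (2 * X) ^+ 3 = 2 * X ^+ 3 by field.
  by rewrite ler_wpM2l.
Qed.

End Constants.

Theorem theorem3 (R : realType) :
  exists c0 c1 c2 : R, [/\ 0 < c0, 0 < c1, 0 < c2 &
  exists l : nat -> R,
    (forall p : nat, (1 <= p)%N ->
       0 < l p <= expR (c1 * p%:R * ln p%:R + c1)) /\
    (forall (p : nat) (D L eps : R),
       (1 <= p)%N -> 0 < D -> 0 < L -> 0 < eps ->
       let r := (1 + p%:R) / p%:R in
       let X := D ^+ (1 + p) * (L / l p) `^ r * eps `^ (- r) in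
       let q := fun x : R => x ^+ 2 * ln (2 * x) in
       let d := `|Num.ceil (Num.max 1 (1 + c2 * q X))%R|%N in
       ((c0 * X)%:E <= complexity eps (@Arand R) (Fdist p D L))%E /\
       ((c0 * X)%:E <= complexity eps (@Arand R)
                         (Fdist p D L `&` [set F | tag F = d]))%E)].
Proof.
(* 100 comes from [ell], and 68 from [exists_block_size]. *)
exists 1, 100, 68; split=> //; exists (@ell R); split.
  by move=> p _; rewrite /ell expR_gt0 lexx.
move=> p D L eps p1 D0 L0 eps0 r X q d.
have l0 : 0 < ell R p by exact: expR_gt0.
have pn0 : p%:R != 0 :> R by rewrite pnatr_eq0 -lt0n.
(* The scale satisfies s^p = ell eps / L, which turns [X] into (D / s)^(p + 1). *)
set b := ell R p * eps / L.
have b0 : 0 < b by rewrite divr_gt0// mulr_gt0.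
set s := b `^ p%:R^-1.
have s0 : 0 < s by exact: powR_gt0.
have sp : s ^+ p = b by rewrite -powR_mulrn ?(ltW s0)// -powRrM mulVf// powRr1// ltW.
have XE : X = D ^+ p.+1 / s ^+ p.+1.
  have -> : s ^+ p.+1 = b `^ r.
    by rewrite -powR_mulrn ?(ltW s0)// -powRrM /r -natr1 addrC mulrC.
  rewrite /X add1n -mulrA; congr (_ * _).
  have Ll0 : 0 < L / ell R p by exact: divr_gt0.
  have E : (L / ell R p) `^ r * b `^ r = eps `^ r.
    rewrite -powRM ?ltW//; congr (_ `^ _); rewrite /b; field.
    by rewrite !gt_eqF.
  by rewrite powRN -E invfM mulrA divff ?mul1r// gt_eqF// powR_gt0.
have X0 : 0 < X by rewrite XE divr_gt0 ?exprn_gt0.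
have dX : Num.max 1 (1 + 68 * q X) <= d%:R.
  rewrite /d natr_absz ger0_norm ?ceil_ge// ceil_ge0.
  by rewrite lt_max (lt_trans (ltrN10 _)).
have [m [m0 md small]] := exists_block_size (ltW X0) dX.
set T := Num.truncn X in md small.
set K := smoothness_const R p.+1.
have K0 : 0 < K.
  by rewrite ltr_pwDl// !mulr_ge0 ?exprn_ge0// addr_ge0// mulr_ge0.
(* The minimizers lie within 2 rho of the origin. *)
set rho := D / 2; have rho0 : 0 < rho by exact: divr_gt0.
have be0 := beta_gt0 R.
(* Makes the gradient bound a beta / s equal to 2 eps. *)
set a := 2 * eps * s / beta R; have a0 : 0 < a by rewrite divr_gt0 ?mulr_gt0.
(* The spike uses exactly half of the smoothness budget [L]. *)
set H := L * rho ^+ p.+1 / (2 * K).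
have H0 : 0 < H by rewrite divr_gt0 ?mulr_gt0// exprn_gt0.
have ell_bound := ell_ge R p1; rewrite -/K in ell_bound.
have sn0 : s != 0 by rewrite gt_eqF.
have Kn0 : K != 0 by rewrite gt_eqF.
have Ln0 : L != 0 by rewrite gt_eqF.
have epsn0 : eps != 0 by rewrite gt_eqF.
have ln0 : ell R p != 0 by rewrite gt_eqF.
have ben0 : beta R != 0 by rewrite gt_eqF.
have aK : a * K / s ^+ p.+1 = 2 * K * L / (beta R * ell R p).
  rewrite /a exprS sp /b; field.
  by rewrite sn0 ben0 ln0 epsn0 Ln0.
have HK : H * K / rho ^+ p.+1 = L / 2.
  rewrite /H; field.
  by rewrite Kn0 gt_eqF ?exprn_gt0.
have be_ell : 0 < beta R * ell R p by exact: mulr_gt0.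
(* This one inequality yields both requirements: the chain uses at most half of [L], and the spike
   is deep enough. *)
have KE : 16 * (2 ^+ p * K * expR 4) <= beta R * ell R p.
  move: ell_bound; rewrite ler_pdivrMr// exprD => ell_bound; lra.
have two_p : 1 <= 2 ^+ p :> R by rewrite exprn_ege1// ler1n.
have e4 : 1 <= expR 4 :> R by rewrite -[leLHS]expR0 ler_expR.
have KEpos : 0 < 2 ^+ p * K * expR 4 by rewrite !mulr_gt0 ?exprn_gt0 ?expR_gt0.
have K_le : K <= 2 ^+ p * K * expR 4.
  rewrite -[leLHS]mulr1 ler_pM ?(ltW K0)//.
  by rewrite ler_peMl// ltW.
have in_class sg : Fdist p D L (existT (fun d => 'rV[R]_d -> R) d (hard m T s rho a H sg)).
  apply: hard_in_Fdist => //; [exact: ltW|exact: ltW| | |].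
  - by rewrite /rho mulrC divfK// pnatr_eq0.
  - apply: (@le_lt_trans _ _ (a * X)); first by rewrite ler_wpM2l ?(ltW a0)// /T truncn_le ltW.
    have -> : a * X = 2 * (L * D ^+ p.+1) / (beta R * ell R p).
      rewrite XE /a [s ^+ p.+1]exprS sp /b; field.
      by rewrite sn0 ben0 ln0 epsn0 Ln0.
    have -> : H * expR (- 4) = L * D ^+ p.+1 / (4 * (2 ^+ p * K * expR 4)).
      rewrite /H /rho expr_div_n [2 ^+ p.+1]exprS expRN; field.
      by rewrite Kn0 gt_eqF ?expR_gt0// gt_eqF// exprn_gt0.
    have W0 : 0 < L * D ^+ p.+1 by rewrite mulr_gt0 ?exprn_gt0.
    rewrite ltr_pdivrMr// [ltRHS]mulrAC ltr_pdivlMr; last by rewrite mulr_gt0.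
    have : L * D ^+ p.+1 * (8 * (2 ^+ p * K * expR 4)) <
           L * D ^+ p.+1 * (beta R * ell R p) by rewrite ltr_pM2l//; lra.
    lra.
  - rewrite aK HK.
    have : 2 * K * L / (beta R * ell R p) <= L / 2; last lra.
    rewrite ler_pdivrMr// [leRHS]mulrAC ler_pdivlMr//.
    have : 4 * K * L <= beta R * ell R p * L by rewrite ler_wpM2r ?(ltW L0)//; lra.
    lra.
have epsE : eps < a * beta R / s.
  rewrite (_ : a * beta R / s = 2 * eps); first lra.
  by rewrite /a; field; rewrite sn0 ben0.
(* [T] is the integer part of [X], so the bound T + 1 exceeds [X] and [c0 = 1] works. *)
have XT : X <= T.+1%:R by rewrite ltW// truncnS_gt.
rewrite mul1r; split.
- apply: (@le_trans _ _ T.+1%:R%:E); first by rewrite lee_fin.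
  exact: (complexity_ge m0 md s0 rho0 (ltW a0) in_class epsE small).
- apply: (@le_trans _ _ T.+1%:R%:E); first by rewrite lee_fin.
  exact: (complexity_ge m0 md s0 rho0 (ltW a0) (fun sg => conj (in_class sg) erefl) epsE small).
Qed.
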